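(* Let $G$ be a contact Carnot group and $p=(x,z)\in G$ with $p\ne p_0$. The set $\Gamma_0(p)$ is finite, and $\Gamma_\infty(p)$ is a closed set homeomorphic to the disjoint union of spheres $$\Gamma_\infty(p)\simeq\bigcup_{\lambda\in\Lambda_p}S^{2N(\lambda)-1},\qquad N(\lambda)=\sum_{j\in L(\lambda)}n_j,$$ where $$\Lambda_p=\Big\{\lambda\in\Lambda\ \Big|\ \Big(z-\sum_{j\notin I_0}\alpha_jg(\lambda\alpha_j)\|x_j\|^2\Big)\lambda>0\Big\}.$$ Moreover the energy function $J$ is constant on each component of $\Gamma(p)$.
   Context: A contact Carnot group $G$ is a connected, simply connected Lie group of dimension $2n+1$ whose Lie algebra of left-invariant vector fields splits as $\mathfrak g=\mathfrak g_1\oplus\mathfrak g_2$ with $\dim\mathfrak g_2=1$, $[\mathfrak g_1,\mathfrak g_1]=\mathfrak g_2$, $[\mathfrak g_1,\mathfrak g_2]=[\mathfrak g_2,\mathfrak g_2]=0$, with a scalar product on $\mathfrak g_1$ having orthonormal basis $f_1,\dots,f_{2n}$. Fix a generator $f_0$ of $\mathfrak g_2$; then $[f_i,f_j]=A_{ij}f_0$ for a skew-symmetric non-degenerate matrix $A$. Exponential coordinates: $p=(x,z)\in\mathbb{R}^{2n}\times\mathbb{R}$ means $p=\exp_G(\sum_i x_if_i+zf_0)$; $p_0=(0,0)$. Let $0<\alpha_1<\dots<\alpha_k$ be the distinct singular values of $A$ with multiplicities $n_j$ (the associated invariant subspace has dimension $2n_j$) and $x_j\in\mathbb{R}^{2n_j}$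 the projection of $x$ on the invariant subspace associated with $\alpha_j$. A geodesic is a non-constant Lipschitz curve $\gamma:[0,1]\to G$, tangent a.e. to $\mathfrak g_1$, locally minimizing the energy $J(\gamma)=\frac12\int_0^1\|\dot\gamma\|^2dt$. With $H(\eta)=\frac12\sum_i\langle\eta,f_i\rangle^2$ on $T^*G$, the exponential map is $\hat E(\eta)=\pi(e^{\vec H}(\eta))$, $\eta\in T_{p_0}^*G$ (the geodesic with initial covector $\eta$ being $t\mapsto\pi(e^{t\vec H}(\eta))$, and $J$ being evaluated on it), and $\Gamma(p)=\hat E^{-1}(p)$ with the subspace topology is the set of geodesics from $p_0$ to $p$. Write $\eta=(u_1,\dots,u_k,\lambda)$, where $u=(\langle\eta,f_i\rangle)_i\in\mathbb{R}^{2n}$, $u_j\in\mathbb{R}^{2n_j}$ is its projection on the invariant subspace of $\alpha_j$, and $\lambda=\langle\eta,f_0\rangle$. Put $I_0=\{j\mid x_j=0\}$, $\Gamma_0(p)=\{(u,\lambda)\in\Gamma(p)\mid\sum_{j\in I_0}\|u_j\|^2=0\}$ and $\Gamma_\infty(p)=\Gamma(p)\setminus\Gamma_0(p)$. Define $g(\lambda)=\frac18\frac{\lambda-\sin\lambda}{(\sin\frac\lambda2)^2}$ (with $g(0)=0$; $g$ is odd, with poles on $2\pi\mathbb{Z}\setminus\{0\}$, where it is given the value $+\infty$ for $\lambda>0$ and $-\infty$ for $\lambda<0$; thus $\lambda\notin\Lambda_p$ if $\lambda\alpha_j$ is a pole of $g$ for some $j\notin I_0$), $\Lambda_j=\frac{2\pi}{\alpha_j}\mathbb{Z}\setminus\{0\}$,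 $\Lambda=\bigcup_{j=1}^k\Lambda_j$, $L(\lambda)=\{j\mid\lambda\in\Lambda_j\}$. *)

(* Defs.v *)
From HB Require Import structures.
From mathcomp Require Import all_boot all_order all_algebra.
From mathcomp Require Import all_classical all_reals all_analysis.

Set Implicit Arguments.
Unset Strict Implicit.
Unset Printing Implicit Defensive.

Import Order.TTheory GRing.Theory Num.Theory.
Import numFieldNormedType.Exports.

Local Open Scope classical_set_scope.
Local Open Scope ring_scope.

(* A contact Carnot group is given by its Lie algebra [cc_alg]: a connected,
   simply connected nilpotent Lie group is determined by its Lie algebra, and
   the exponential identifies it with that algebra (see [bch]). *)
Record contact_carnot (R : realType) (n : nat) := ContactCarnot {
  cc_alg :> vectType R;
  cc_br : cc_alg -> cc_alg -> cc_alg;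
  cc_br_linearl : forall (a : R) (u v w : cc_alg),
    cc_br (a *: u + v) w = a *: cc_br u w + cc_br v w;
  cc_br_linearr : forall (a : R) (u v w : cc_alg),
    cc_br w (a *: u + v) = a *: cc_br w u + cc_br w v;
  cc_br_alternating : forall u, cc_br u u = 0;
  cc_br_jacobi : forall u v w,
    cc_br u (cc_br v w) + cc_br v (cc_br w u) + cc_br w (cc_br u v) = 0;
  cc_g1 : {vspace cc_alg};
  cc_g2 : {vspace cc_alg};
  cc_dim : \dim (fullv : {vspace cc_alg}) = n.*2.+1;
  cc_split : (cc_g1 + cc_g2)%VS = fullv;
  cc_direct : directv (cc_g1 + cc_g2);
  cc_dim2 : \dim cc_g2 = 1;
  (* [g1, g1] is spanned by the brackets of the elements of a basis *)
  cc_br11 :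
    <<[seq cc_br u v | u <- vbasis cc_g1, v <- vbasis cc_g1]>>%VS = cc_g2;
  cc_br12 : forall u v, u \in cc_g1 -> v \in cc_g2 -> cc_br u v = 0;
  cc_br22 : forall u v, u \in cc_g2 -> v \in cc_g2 -> cc_br u v = 0;
  (* the contact condition, i.e., non-degeneracy of the matrix [bracket_mx] *)
  cc_contact : forall u, u \in cc_g1 ->
    (forall v, v \in cc_g1 -> cc_br u v = 0) -> u = 0;
  (* the scalar product is meaningful on g1 only *)
  cc_dot : cc_alg -> cc_alg -> R;
  cc_dot_linear : forall (a : R) (u v w : cc_alg),
    u \in cc_g1 -> v \in cc_g1 -> w \in cc_g1 ->
    cc_dot (a *: u + v) w = a * cc_dot u w + cc_dot v w;
  cc_dot_sym : forall u v, u \in cc_g1 -> v \in cc_g1 ->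
    cc_dot u v = cc_dot v u;
  cc_dot_pos : forall u, u \in cc_g1 -> u != 0 -> 0 < cc_dot u u
}.

Record adapted_frame (R : realType) (n : nat) (G : contact_carnot R n) :=
  AdaptedFrame {
  frame1 : (n.*2).-tuple G;
  frame0 : G;
  frame1_basis : basis_of (cc_g1 G) frame1;
  frame1_orthonormal : forall i j : 'I_(n.*2),
    cc_dot (tnth frame1 i) (tnth frame1 j) = (i == j)%:R;
  frame0_gen : <[frame0]>%VS = cc_g2 G
}.

(* Coordinates (x, z) of points, tangent vectors and covectors. *)
Notation coords R n := ('rV[R]_(n.*2) * R)%type.

Section Euclidean.
Context {R : realType}.

Definition sqnorm (d : nat) (v : 'rV[R]_d) : R := \sum_(i < d) v 0 i ^+ 2.

Definition unit_sphere (d : nat) : set 'rV[R]_d := [set v | sqnorm v = 1].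

Definition homeomorphic (X Y : topologicalType) : Prop :=
  exists (f : X -> Y) (g : Y -> X),
    [/\ cancel f g, cancel g f, continuous f & continuous g].

End Euclidean.
Arguments unit_sphere : clear implicits.

Section CarnotGroup.
Context {R : realType} {n : nat} {G : contact_carnot R n}.
Variable F : adapted_frame G.

Let full_frame : (n.*2).+1.-tuple G := [tuple of frame0 F :: frame1 F].

Definition exp_coords (p : coords R n) : G :=
  \sum_(i < n.*2) p.1 0 i *: tnth (frame1 F) i + p.2 *: frame0 F.

Definition log_coords (w : G) : coords R n :=
  (\row_i coord full_frame (lift ord0 i) w, coord full_frame ord0 w).

(* The Baker-Campbell-Hausdorff product; all brackets of order at least three
   vanish, so exp u * exp v = exp (bch u v). *)
Definition bch (u v : G) : G := u + v + 2^-1 *: cc_br u v.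

Definition group_mul (p q : coords R n) : coords R n :=
  log_coords (bch (exp_coords p) (exp_coords q)).

(* [f_i, f_j] = bracket_mx i j *: f_0 *)
Definition bracket_mx : 'M[R]_(n.*2) :=
  \matrix_(i, j)
    coord full_frame ord0 (cc_br (tnth (frame1 F) i) (tnth (frame1 F) j)).

(* The left-invariant vector field equal to w at the identity, evaluated at p:
   the velocity at t = 0 of t |-> p * exp (t w). *)
Definition left_invariant (w p : coords R n) : coords R n :=
  derive1 (fun t : R => group_mul p (t *: w)) 0.

Definition frame_field (i : 'I_(n.*2)) : coords R n -> coords R n :=
  left_invariant (delta_mx 0 i, 0).

Definition pairing (eta v : coords R n) : R :=
  \sum_(i < n.*2) eta.1 0 i * v.1 0 i + eta.2 * v.2.

(* A point of the cotangent bundle is a pair (q, eta) with q in G and eta the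
   covector \sum_i eta.1 0 i dx_i + eta.2 dz at q. *)
Definition hamiltonian (s : coords R n * coords R n) : R :=
  2^-1 * \sum_(i < n.*2) pairing s.2 (frame_field i s.1) ^+ 2.

Definition gradient (h : coords R n -> R) (v : coords R n) : coords R n :=
  (\row_i derive h v (delta_mx 0 i, 0), derive h v (0, 1)).

Definition hamiltonian_field (s : coords R n * coords R n) :
    coords R n * coords R n :=
  (gradient (fun eta => hamiltonian (s.1, eta)) s.2,
   - gradient (fun q => hamiltonian (q, s.2)) s.1).

Definition hamiltonian_curve (c : R -> coords R n * coords R n) : Prop :=
  forall t : R, is_derive t 1 c (hamiltonian_field (c t)).

(* The integral curve t |-> e^(t H) (eta) issued from the covector eta at the
   identity (0, 0). As the frame fields are the coordinate fields at (0, 0),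
   eta = (u, lambda) with u_i = <eta, f_i> and lambda = <eta, f_0>. *)
Definition lift_of (eta : coords R n) : R -> coords R n * coords R n :=
  xget (fun=> 0) [set c | hamiltonian_curve c /\ c 0 = (0, eta)].

Definition geodesic (eta : coords R n) : R -> coords R n :=
  fun t => (lift_of eta t).1.

Definition exponential_map (eta : coords R n) : coords R n := geodesic eta 1.

Definition Gamma (p : coords R n) : set (coords R n) :=
  [set eta | exponential_map eta = p].

(* A horizontal velocity \sum_i v_i f_i has x-coordinates v, and the f_i are
   orthonormal, so that its squared norm is the Euclidean one of v. *)
Definition energy (gamma : R -> coords R n) : R :=
  2^-1 * Rintegral lebesgue_measure `[0, 1]
           (fun t => sqnorm (derive1 gamma t).1).

Definition J (eta : coords R n) : R := energy (geodesic eta).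

End CarnotGroup.

Section SingularValues.
Context {R : realType} {d : nat}.
Variable A : 'M[R]_d.

Definition singular_value (a : R) : Prop :=
  0 <= a /\ eigenvalue (A^T *m A) (a ^+ 2).

Definition invariant_space (a : R) : 'M[R]_d := eigenspace (A^T *m A) (a ^+ 2).

(* Orthogonal projection: the rows of kermx V^T span the orthogonal complement
   of the row space of V. *)
Definition orth_proj (V : 'M[R]_d) (x : 'rV[R]_d) : 'rV[R]_d :=
  x *m proj_mx V (kermx V^T).

Record distinct_singular_values (k : nat) (alpha : 'I_k -> R)
    (m : 'I_k -> nat) : Prop := {
  dsv_pos : forall j, 0 < alpha j;
  dsv_increasing : forall i j : 'I_k, (i < j)%N -> alpha i < alpha j;
  dsv_values : forall a, singular_value a <-> exists j, alpha j = a;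
  dsv_mult : forall j, \rank (invariant_space (alpha j)) = (m j).*2
}.

End SingularValues.

Section Topology.
Context {R : realType} {n : nat} {G : contact_carnot R n}.
Variables (F : adapted_frame G) (k : nat) (alpha : 'I_k -> R) (m : 'I_k -> nat).

Definition component_of (j : 'I_k) (x : 'rV[R]_(n.*2)) : 'rV[R]_(n.*2) :=
  orth_proj (invariant_space (bracket_mx F) (alpha j)) x.

Definition I0 (x : 'rV[R]_(n.*2)) : {pred 'I_k} :=
  [pred j | component_of j x == 0].

Definition Gamma0 (p : coords R n) : set (coords R n) :=
  [set eta | Gamma F p eta /\
    \sum_(j in I0 p.1) sqnorm (component_of j eta.1) = 0].

Definition Gamma_inf (p : coords R n) : set (coords R n) :=
  Gamma F p `\` Gamma0 p.

Definition g (l : R) : \bar R :=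
  if l == 0 then 0%E
  else if sin (l / 2) == 0 then (if 0 < l then +oo%E else -oo%E)
  else (8^-1 * ((l - sin l) / sin (l / 2) ^+ 2))%:E.

Definition Lambda_ (j : 'I_k) : set R :=
  [set l | l != 0 /\ exists q : int, l = 2 * pi / alpha j * q%:~R].

Definition Lambda : set R := \bigcup_j Lambda_ j.

Definition L (l : R) : {pred 'I_k} := [pred j | l \in Lambda_ j].

Definition N (l : R) : nat := (\sum_(j in L l) m j)%N.

Definition Lambda_p (p : coords R n) : set R :=
  [set l | Lambda l /\
    (0 < (p.2%:E - \sum_(j < k | j \notin I0 p.1)
           (alpha j)%:E * g (l * alpha j)
             * (sqnorm (component_of j p.1))%:E) * l%:E)%E].

(* S^(2 N - 1) is the unit sphere of R^(2 N). *)
Definition spheres (p : coords R n) : topologicalType :=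
  {l : Lambda_p p & unit_sphere R (N (set_val l)).*2}.

End Topology.

(* Main.v *)
Require Import Defs.
From HB Require Import structures.
From mathcomp Require Import all_boot all_order all_algebra.
From mathcomp Require Import all_classical all_reals all_analysis.
From mathcomp Require Import ring lra.

(* The Hamiltonian flow is explicit. With h the vector of momenta <eta, f_i> and
   A the bracket matrix, lambda is constant, h' = lambda h A, x' = h and
   z' = (xA).h / 2. The symmetric matrix A^T A splits R^(2n) orthogonally into
   the invariant subspaces of the alpha_j, on each of which A / alpha_j is a
   complex structure, so that the flow is a rotation of angle
   w_j t = lambda alpha_j t on the j-th one. At time 1 this gives
   |x_j|^2 = 4 sin(w_j / 2)^2 / w_j^2 |u_j|^2, and u_j contributes
   |u_j|^2 (w_j - sin w_j) / (2 lambda w_j) to z.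

   For lambda <> 0 the equation E(u, lambda) = (x, z) thus says: x_j = 0 for
   j in L(lambda); u_j is determined by x_j for the other j, and its
   contribution to z is then alpha_j g(w_j) |x_j|^2; the remaining components
   satisfy sum_(j in L(lambda)) |u_j|^2 =
   2 lambda (z - sum_(j notin I_0) alpha_j g(w_j) |x_j|^2).
   The last equation is a sphere when its right-hand side is positive, and
   Lambda is discrete, which describes Gamma_inf. On Gamma_0 the right-hand side
   vanishes; since g is strictly convex between two consecutive positive poles,
   this has at most two solutions lambda in each cell, and g grows at least
   linearly, so only finitely many cells matter. Finally |u|^2 is determined by
   lambda on Gamma(p), and lambda takes countably many values there, hence is
   constant on connected components. *)

Set Implicit Arguments.
Unset Strict Implicit.
Unset Printing Implicit Defensive.

Import Order.TTheory GRing.Theory Num.Theory.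
Import numFieldNormedType.Exports.

Local Open Scope classical_set_scope.
Local Open Scope ring_scope.

(** * Continuity of sums and products of maps *)

Lemma continuous_sumr (R : realType) (T : topologicalType)
    (V : normedModType R) (I : finType) (f : I -> T -> V) :
  (forall i, continuous (f i)) -> continuous (fun x => \sum_i f i x).
Proof.
move=> fc; apply: (@continuous_big V I +%R 0 predT) => [|i _]; last exact: fc.
exact: add_continuous.
Qed.

Lemma continuous_mulr (R : realType) (T : topologicalType) (f g : T -> R) :
  continuous f -> continuous g -> continuous (fun x => f x * g x).
Proof. by move=> fc gc x; exact: cvgM (fc x) (gc x). Qed.

Lemma continuous_scaler (R : realType) (T : topologicalType)
    (V : normedModType R) (f : T -> R) (g : T -> V) :
  continuous f -> continuous g -> continuous (fun x => f x *: g x).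
Proof. by move=> fc gc x; exact: cvgZ (fc x) (gc x). Qed.

(** * The Euclidean scalar product on row vectors *)

Section DotProduct.
Context {R : realType} {d : nat}.
Implicit Types u v w : 'rV[R]_d.

Definition dotv u v : R := (u *m v^T) 0 0.

Lemma dotvE u v : dotv u v = \sum_i u 0 i * v 0 i.
Proof. by rewrite /dotv mxE; apply: eq_bigr => i _; rewrite mxE. Qed.

Lemma dotvC u v : dotv u v = dotv v u.
Proof. by rewrite !dotvE; apply: eq_bigr => i _; rewrite mulrC. Qed.

Lemma dotvDl u v w : dotv (u + v) w = dotv u w + dotv v w.
Proof. by rewrite /dotv mulmxDl mxE. Qed.

Lemma dotvDr u v w : dotv w (u + v) = dotv w u + dotv w v.
Proof. by rewrite dotvC dotvDl !(dotvC w). Qed.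

Lemma dotvZl a u v : dotv (a *: u) v = a * dotv u v.
Proof. by rewrite /dotv -scalemxAl mxE. Qed.

Lemma dotvZr a u v : dotv u (a *: v) = a * dotv u v.
Proof. by rewrite dotvC dotvZl dotvC. Qed.

Lemma dotvNl u v : dotv (- u) v = - dotv u v.
Proof. by rewrite -scaleN1r dotvZl mulN1r. Qed.

Lemma dotvBl u v w : dotv (u - v) w = dotv u w - dotv v w.
Proof. by rewrite dotvDl dotvNl. Qed.

Lemma dotv0r u : dotv u 0 = 0.
Proof. by rewrite dotvE big1// => i _; rewrite mxE mulr0. Qed.

Lemma dotv_delta u i : dotv u (delta_mx 0 i) = u 0 i.
Proof.
rewrite dotvE (bigD1 i)//= big1 ?addr0 => [|j /negPf ji].
  by rewrite mxE !eqxx mulr1.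
by rewrite mxE eqxx ji mulr0.
Qed.

Lemma dotv_suml (I : finType) (P : pred I) (f : I -> 'rV[R]_d) v :
  dotv (\sum_(i | P i) f i) v = \sum_(i | P i) dotv (f i) v.
Proof. by rewrite /dotv mulmx_suml summxE. Qed.

Lemma dotv_mulmx u v (M : 'M[R]_d) : dotv (u *m M) v = dotv u (v *m M^T).
Proof. by rewrite /dotv trmx_mul trmxK mulmxA. Qed.

Lemma dotv_skew (M : 'M[R]_d) u : M^T = - M -> dotv u (u *m M) = 0.
Proof.
move=> M_skew; have : dotv u (u *m M) = - dotv u (u *m M).
  by rewrite {1}dotvC dotv_mulmx M_skew mulmxN dotvC dotvNl dotvC.
by move/eqP; rewrite -subr_eq0 opprK -mulr2n mulrn_eq0 => /eqP.
Qed.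

Lemma sqnormE u : sqnorm u = dotv u u.
Proof. by rewrite dotvE; apply: eq_bigr => i _; rewrite expr2. Qed.

Lemma sqnorm_ge0 u : 0 <= sqnorm u.
Proof. by apply: sumr_ge0 => i _; exact: sqr_ge0. Qed.

Lemma sqnorm_eq0 u : (sqnorm u == 0) = (u == 0).
Proof.
apply/idP/eqP => [|->].
  rewrite psumr_eq0; last by move=> i _; exact: sqr_ge0.
  move/allP => u0; apply/rowP => i; rewrite mxE; apply/eqP.
  by rewrite -sqrf_eq0; apply: u0; rewrite mem_index_enum.
by rewrite /sqnorm big1 // => i _; rewrite mxE expr0n.
Qed.

Lemma sqnorm0 : sqnorm (0 : 'rV[R]_d) = 0.
Proof. by apply/eqP; rewrite sqnorm_eq0. Qed.

Lemma sqnorm_gt0 u : (0 < sqnorm u) = (u != 0).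
Proof. by rewrite lt_neqAle sqnorm_ge0 andbT eq_sym sqnorm_eq0. Qed.

Lemma sqnormZ a u : sqnorm (a *: u) = a ^+ 2 * sqnorm u.
Proof. by rewrite !sqnormE dotvZl dotvZr mulrA expr2. Qed.

Lemma sqnormD u v : sqnorm (u + v) = sqnorm u + 2 * dotv u v + sqnorm v.
Proof. rewrite !sqnormE dotvDl !dotvDr (dotvC v u); ring. Qed.

Lemma sqr_coord_le_sqnorm u i : u 0 i ^+ 2 <= sqnorm u.
Proof.
rewrite /sqnorm (bigD1 i) //= lerDl; apply: sumr_ge0 => j _; exact: sqr_ge0.
Qed.

Lemma sqnorm_continuous : continuous (@sqnorm R d).
Proof.
rewrite (_ : @sqnorm R d = fun v => \sum_i v 0 i * v 0 i); last first.
  by apply/funext => v; rewrite sqnormE dotvE.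
by apply: continuous_sumr => i; apply: continuous_mulr; exact: coord_continuous.
Qed.

End DotProduct.

Lemma mulmxr_continuous (R : realType) (d e : nat) (M : 'M[R]_(d, e)) :
  continuous (fun v : 'rV[R]_d => v *m M).
Proof.
rewrite (_ : mulmx^~ M = fun v : 'rV_d => \sum_i v 0 i *: row i M); last first.
  by apply/funext => v; exact: mulmx_sum_row.
apply: continuous_sumr => i; apply: continuous_scaler.
  exact: coord_continuous.
exact: cst_continuous.
Qed.

Lemma closed_preimage1 (R : realType) (T : topologicalType)
    (V : normedModType R) (f : T -> V) (a : V) :
  continuous f -> closed [set x | f x = a].
Proof.
move=> /continuous_closedP /(_ [set a]); apply.
by apply: accessible_closed_set1; exact/hausdorff_accessible/norm_hausdorff.
Qed.

(** * Eigenvectors of real symmetric matrices *)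

Section RealSymmetric.
Context {R : realType} {d : nat} (S : 'M[R]_d).
Hypothesis S_sym : S^T = S.

Let rayleigh (v : 'rV[R]_d) : R := dotv (v *m S) v.

Let rayleigh_continuous : continuous rayleigh.
Proof.
rewrite (_ : rayleigh = fun v => \sum_i (v *m S) 0 i * v 0 i); last first.
  by apply/funext => w; exact: dotvE.
apply: continuous_sumr => i; apply: continuous_mulr.
  move=> v; apply: (@continuous_comp _ _ _ (mulmxr S) (fun v : 'rV_d => v 0 i)).
    exact: mulmxr_continuous.
  exact: coord_continuous.
exact: coord_continuous.
Qed.

(* A maximiser of the Rayleigh quotient on an invariant subspace is an
   eigenvector. *)
Lemma invariant_subspace_eigenvector (W : 'M[R]_d) :
  W != 0 -> (W *m S <= W)%MS ->
  exists v a, [/\ v != 0, (v <= W)%MS & v *m S = a *: v :> 'rV[R]_d].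
Proof.
move=> W0 WS.
(* The unit vectors of the row space of [W]; membership is written with [cokermx] so that it is a
   closed condition. *)
pose B := [set v : 'rV[R]_d | sqnorm v = 1 /\ v *m cokermx W = 0].
have BP v : (v <= W)%MS -> v != 0 -> B ((Num.sqrt (sqnorm v))^-1 *: v).
  move=> vW v0; split; last first.
    by rewrite -scalemxAl; move: vW; rewrite submxE => /eqP ->; rewrite scaler0.
  rewrite sqnormZ exprVn sqr_sqrtr ?sqnorm_ge0// mulVf//.
  by rewrite sqnorm_eq0.
have B0 : B !=set0.
  have /rowV0Pn[v vW v0] := W0.
  by exists ((Num.sqrt (sqnorm v))^-1 *: v); exact: BP.
have cB : compact B.
  apply: bounded_closed_compact.
    exists 1; split => // M M1 v [v1 _] /=.
    (* The norm on matrices is the maximum norm, so it is bounded coordinate by coordinate. *)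
    have -> : `|v| = mx_norm v by []; rewrite mx_normrE; apply/bigmax_leP; split => /= [|[i j] _]; first lra.
    rewrite ord1; apply: le_trans (ltW M1).
    rewrite -(@ler_pXn2r _ 2) ?nnegrE // expr1n real_normK ?num_real // -v1.
    exact: sqr_coord_le_sqnorm.
  apply: (@closedI _ [set v | sqnorm v = 1] [set v | v *m cokermx W = 0]).
    exact: closed_preimage1 sqnorm_continuous.
  by apply: closed_preimage1; exact: mulmxr_continuous.
have [c] := @EVT_max_rV R d rayleigh B B0 cB
  (continuous_subspaceT rayleigh_continuous).
rewrite inE => -[c1 cW'] cmax.
have cW : (c <= W)%MS by rewrite submxE cW'.
set M := rayleigh c in cmax.
have quad v : (v <= W)%MS -> rayleigh v <= M * sqnorm v.
  move=> vW; have [->|v0] := eqVneq v 0.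
    by rewrite /rayleigh mul0mx /dotv mul0mx mxE sqnorm0 mulr0.
  have := cmax _ (mem_set (BP _ vW v0)).
  rewrite /rayleigh -scalemxAl dotvZl dotvZr mulrA -expr2 exprVn.
  rewrite sqr_sqrtr ?sqnorm_ge0// mulrC ler_pdivrMr//.
  by rewrite sqnorm_gt0.
pose w := c *m S - M *: c.
have wW : (w <= W)%MS.
  rewrite /w addmx_sub ?eqmx_opp ?scalemx_sub//.
  by apply: submx_trans WS; exact: submxMr.
have c0 : c != 0 by rewrite -sqnorm_eq0 c1 oner_neq0.
exists c, M; split => //; apply/eqP; rewrite -subr_eq0 -/w -sqnorm_eq0.
pose b := sqnorm w; pose e := rayleigh w - M * b.
(* Maximality of [c] tested at c + t w. The first-order term is 2 t |w|^2 because <c S, w> = |w|^2 +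
   M <c, w>. *)
have key t : 2 * t * b + t ^+ 2 * e <= 0.
  have := quad (c + t *: w); rewrite addmx_sub ?scalemx_sub// => /(_ isT).
  rewrite sqnormD dotvZr sqnormZ c1 /rayleigh mulmxDl -scalemxAl.
  rewrite dotvDl !(dotvDr c (t *: w)) !dotvZl !dotvZr -/(rayleigh w) -/(rayleigh c).
  rewrite [dotv (w *m S) c]dotv_mulmx S_sym (dotvC w (c *m S)).
  have -> : dotv (c *m S) w = b + M * dotv c w.
    by rewrite /b sqnormE -dotvZl -dotvDl subrK.
  rewrite -/M -/b /e => h.
  rewrite -subr_ge0 in h; rewrite -subr_ge0; apply: le_trans h _.
  by rewrite le_eqVlt; apply/orP; left; apply/eqP; ring.
have b0 : 0 <= b by exact: sqnorm_ge0.
rewrite -/b eq_le b0 andbT leNgt; apply/negP => bpos.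
have d0 : 0 < b + `|e| by rewrite ltr_pwDl.
(* This t satisfies t (b + |e|) = b, whence 2 t b + t^2 e >= t b + t^2 b > 0. *)
have := key (b / (b + `|e|)).
rewrite leNgt => /negP; apply.
have t0 : 0 < b / (b + `|e|) by rewrite divr_gt0.
set t := b / _ in t0 *.
have tE : t * (b + `|e|) = b by rewrite /t mulfVK ?gt_eqF.
have e1 : - `|e| <= e by rewrite lerNl -normrN ler_norm.
have e0 := normr_ge0 e.
have h1 : 0 < t * b by rewrite mulr_gt0.
have h2 : 0 <= t ^+ 2 * (e + `|e|) by rewrite mulr_ge0 ?sqr_ge0//; lra.
have h3 : t ^+ 2 * `|e| = t * b - t * (t * b).
  have h : t * (t * (b + `|e|)) = t * b by rewrite tE.
  by move: h; clear -h1; lra.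
have h4 : 0 < t * (t * b) by rewrite mulr_gt0.
rewrite mulrDr in h2; lra.
Qed.

End RealSymmetric.

(** * Orthogonal complements *)

Section OrthogonalProjection.
Context {R : realType} {d : nat} (V : 'M[R]_d).

(** A vector in both spaces is orthogonal to itself, hence 0 by positivity. *)
Lemma capmx_orth : (V :&: kermx V^T)%MS = 0.
Proof.
apply/eqP/rowV0P => v; rewrite sub_capmx => /andP[/submxP[y vE] /sub_kermxP v0].
apply/eqP; rewrite -sqnorm_eq0 sqnormE /dotv {2}vE trmx_mul mulmxA v0.
by rewrite mul0mx mxE.
Qed.

Lemma addsmx_orth (v : 'rV[R]_d) : (v <= V + kermx V^T)%MS.
Proof.
have /eqP rk : \rank (V + kermx V^T)%MS == d.
  rewrite mxrank_disjoint_sum ?capmx_orth// mxrank_ker mxrank_tr.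
  by rewrite subnKC// rank_leq_row.
by apply: submx_full; rewrite /row_full rk.
Qed.

End OrthogonalProjection.

(** * Spectral projections of A^T A for a skew matrix A *)

Section SkewSpectral.
Context {R : realType} {d : nat} (A : 'M[R]_d).
Context {k : nat} (alpha : 'I_k -> R) (m : 'I_k -> nat).
Hypothesis A_skew : A^T = - A.
Hypothesis Halpha : distinct_singular_values A alpha m.

Let E j := invariant_space A (alpha j).

(** The matrix of [orth_proj] onto the j-th invariant space, so that u P_j is by definition the
    component u_j. *)
Definition spec_proj (j : 'I_k) : 'M[R]_d :=
  proj_mx (invariant_space A (alpha j)) (kermx (invariant_space A (alpha j))^T).

Local Notation P := spec_proj.
Let S := A^T *m A.

Let S_sym : S^T = S. Proof. by rewrite /S trmx_mul trmxK. Qed.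

Let SE : S = - (A *m A). Proof. by rewrite /S A_skew mulNmx. Qed.

Lemma alpha_inj : injective alpha.
Proof.
have lt := dsv_increasing Halpha.
move=> i j ij; apply: val_inj; case: (ltngtP (val i) (val j)) => // /lt.
  by rewrite ij ltxx.
by rewrite ij ltxx.
Qed.

Lemma sqr_alpha_inj : injective (fun j => alpha j ^+ 2).
Proof.
move=> i j /= /eqP; rewrite eqrXn2 ?ltW ?(dsv_pos Halpha)// => /eqP.
exact: alpha_inj.
Qed.

Let eigenP j p (v : 'M[R]_(p, d)) :
  reflect (v *m S = alpha j ^+ 2 *: v) (v <= E j)%MS.
Proof. exact: eigenspaceP. Qed.

Let orth_eigen i j (u v : 'rV[R]_d) : i != j ->
  (u <= E i)%MS -> (v <= E j)%MS -> dotv u v = 0.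
Proof.
move=> ij /eigenP uE /eigenP vE.
have : alpha i ^+ 2 * dotv u v = alpha j ^+ 2 * dotv u v.
  by rewrite -dotvZl -uE dotv_mulmx S_sym vE dotvZr.
move/eqP; rewrite -subr_eq0 -mulrBl mulf_eq0 => /orP[|/eqP//].
by rewrite subr_eq0 => /eqP /sqr_alpha_inj /eqP; rewrite (negPf ij).
Qed.

Let proj_id j p (v : 'M[R]_(p, d)) : (v <= E j)%MS -> v *m P j = v.
Proof. by move=> vE; rewrite proj_mx_id ?capmx_orth. Qed.

Let proj_other i j (v : 'rV[R]_d) : i != j -> (v <= E i)%MS -> v *m P j = 0.
Proof.
move=> ij vE; rewrite proj_mx_0 ?capmx_orth//; apply/sub_kermxP/rowP => l.
rewrite !mxE; transitivity (dotv v (row l (E j))).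
  by rewrite dotvE; apply: eq_bigr => a _; rewrite !mxE.
by rewrite (orth_eigen ij) ?row_sub.
Qed.

Let proj_other_mx i j p (M : 'M[R]_(p, d)) :
  i != j -> (M <= E i)%MS -> M *m P j = 0.
Proof.
move=> ij ME; apply/row_matrixP => l; rewrite row_mul row0 (proj_other ij)//.
exact: submx_trans (row_sub _ _) ME.
Qed.

Let proj_sub j : (P j <= E j)%MS.
Proof. by rewrite -[P j]mul1mx proj_mx_sub. Qed.

(* The orthogonal complement of the sum of the eigenspaces is invariant, so if
   it were nonzero it would contain an eigenvector. *)
Let sum_eigen (v : 'rV[R]_d) : (v <= \sum_j E j)%MS.
Proof.
set V := (\sum_j E j)%MS; pose W := kermx V^T.
have [W0|Wn0] := eqVneq W 0.
  apply: submx_trans (addsmx_orth V v) _.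
  by rewrite -/W W0 addsmx_sub submx_refl sub0mx.
(* As [S] is symmetric, the complement of an [S]-invariant space is again [S]-invariant. *)
have WS : (W *m S <= W)%MS.
  apply/sub_kermxP; rewrite -mulmxA -[S]trmxK -trmx_mul S_sym.
  have VS : (V *m S <= V)%MS.
    rewrite /V sumsmxMr; apply/sumsmx_subP => j _; apply: (sumsmx_sup j) => //.
    by have /eigenP -> := submx_refl (E j); rewrite scalemx_sub.
  have /submxP[X ->] := VS.
  by rewrite trmx_mul mulmxA mulmx_ker mul0mx.
(* Here a |u|^2 = |u A^T|^2, so a >= 0 and its square root is a singular value, hence some alpha_j.
   Then [u] lies both in [V] and in its complement. *)
have [u [a [u0 uW uS]]] := invariant_subspace_eigenvector S_sym Wn0 WS.
have a0 : 0 <= a.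
  have : a * sqnorm u = sqnorm (u *m A^T).
    by rewrite !sqnormE -dotvZl -uS /S mulmxA dotv_mulmx.
  move=> h; have : 0 <= a * sqnorm u by rewrite h sqnorm_ge0.
  by rewrite pmulr_lge0 ?sqnorm_gt0.
have [j ja] : exists j, alpha j = Num.sqrt a.
  apply/(dsv_values Halpha); split; first exact: sqrtr_ge0.
  rewrite sqr_sqrtr//; apply/eigenvalueP; exists u => //.
have uV : (u <= V)%MS.
  apply: (sumsmx_sup j) => //; apply/eigenP.
  by rewrite ja sqr_sqrtr.
have : (u <= V :&: W)%MS by rewrite sub_capmx uV.
by rewrite capmx_orth submx0 (negPf u0).
Qed.

Lemma spec_projM j : P j *m P j = P j.
Proof. exact: proj_id. Qed.

Lemma spec_proj_orth i j : i != j -> P i *m P j = 0.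
Proof. by move=> ij; exact: (proj_other_mx ij). Qed.

Let sum_proj (v : 'rV[R]_d) : \sum_j v *m P j = v.
Proof.
have /sub_sumsmxP[u uE] := sum_eigen v.
rewrite {2}uE; apply: eq_bigr => j _.
rewrite {1}uE mulmx_suml (bigD1 j)//= proj_id ?submxMl// big1 ?addr0// => i ij.
by rewrite (proj_other ij)// submxMl.
Qed.

Lemma sum_spec_proj : \sum_j P j = 1%:M.
Proof.
apply/row_matrixP => l; rewrite -[RHS]sum_proj -mulmx_sumr -row_mul.
by rewrite mul1mx.
Qed.

(** By skewness [S] is - A^2, which commutes with [A]. *)
Let eigen_stable j p (v : 'M[R]_(p, d)) : (v <= E j)%MS -> (v *m A <= E j)%MS.
Proof.
move=> /eigenP vE; apply/eigenP.
have -> : v *m A *m S = v *m S *m A.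
  by rewrite SE !mulmxN !mulNmx !mulmxA.
by rewrite vE -scalemxAl.
Qed.

(** Expanding 1 as the sum of the P_i in front of A P_j, stability of the eigenspaces under [A]
    kills all terms but i = j. *)
Lemma spec_proj_comm j : A *m P j = P j *m A.
Proof.
rewrite -[in LHS](mul1mx A) -sum_spec_proj !mulmx_suml (bigD1 j)//= big1.
  by rewrite addr0 proj_id// eigen_stable.
by move=> i ij; rewrite (proj_other_mx ij)// eigen_stable.
Qed.

Lemma spec_proj_sqr j : P j *m A *m A = - (alpha j ^+ 2) *: P j.
Proof.
have /eigenP := proj_sub j.
by rewrite SE mulmxN mulmxA scaleNr => <-; rewrite opprK.
Qed.

(** Inserting the sum of the projections gives P_j^T = P_j P_j^T, and the right-hand side is
    symmetric. *)
Lemma spec_proj_tr j : (P j)^T = P j.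
Proof.
have H i l : i != l -> P i *m (P l)^T = 0.
  move=> il; apply/matrixP => a b; rewrite !mxE.
  transitivity (dotv (row a (P i)) (row b (P l))).
    by rewrite dotvE; apply: eq_bigr => c _; rewrite !mxE.
  by rewrite (orth_eigen il)//; apply: submx_trans (row_sub _ _) (proj_sub _).
have PT : (P j)^T = P j *m (P j)^T.
  rewrite -[LHS]mul1mx -sum_spec_proj mulmx_suml (bigD1 j)//= big1 ?addr0//.
  by move=> i ij; exact: H.
have := congr1 trmx PT; rewrite (trmx_mul (P j)) !trmxK => PT2.
by rewrite PT -PT2.
Qed.

(** Provides the dimension 2 N(lambda) of the space carrying a sphere: the row space is the sum of
    the eigenspaces, and these are independent since the alpha_j^2 are distinct. *)
Lemma rank_sum_spec_proj (Q : pred 'I_k) :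
  \rank (\sum_(j | Q j) P j)%R = (\sum_(j | Q j) m j).*2.
Proof.
have -> : \rank (\sum_(j | Q j) P j)%R = \rank (\sum_(j | Q j) E j)%MS.
  apply/eqP; rewrite eqn_leq; apply/andP; split; apply: mxrankS.
    by apply: summx_sub => j Qj; apply: (sumsmx_sup j).
  apply/sumsmx_subP => j Qj.
  have -> : E j = E j *m \sum_(j | Q j) P j.
    rewrite mulmx_sumr (bigD1 j)//= proj_id// big1 ?addr0// => i /andP[_ ij].
    by apply: (@proj_other_mx j); rewrite // eq_sym.
  exact: submxMl.
have inj : {in Q &, injective (fun j => alpha j ^+ 2)}.
  by move=> i j _ _; exact: sqr_alpha_inj.
have /mxdirectP /= -> := mxdirect_sum_eigenspace S inj.
rewrite -muln2 big_distrl /=; apply: eq_bigr => j _.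
by rewrite muln2 -(dsv_mult Halpha).
Qed.

End SkewSpectral.

(** * Linear maps given by a linearity hypothesis *)

Section LinearFunctions.
Context {R : realType} {U V : lmodType R} (f : U -> V).
Hypothesis f_lin : linear f.

Let F : {linear U -> V} := HB.pack f (GRing.isLinear.Build _ _ _ _ _ f_lin).

Lemma lin_sub u v : f (u - v) = f u - f v.
Proof. exact: (linearB F). Qed.

Lemma lin_scale a u : f (a *: u) = a *: f u.
Proof. exact: (linearZ_LR F). Qed.

Lemma lin_add u v : f (u + v) = f u + f v.
Proof. exact: (linearD F). Qed.

Lemma lin_comb (I : finType) (a : I -> R) (u : I -> U) :
  f (\sum_i a i *: u i) = \sum_i a i *: f (u i).
Proof.
rewrite -[LHS]/(F _) linear_sum; apply: eq_bigr => i _; exact: (linearZ_LR F).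
Qed.

End LinearFunctions.

(** * Derivatives of vector-valued curves *)

Section Derivatives.
Context {R : realType}.

(** The bare limit of difference quotients is the form to which continuous linear maps and pairing
    can be applied. *)
Lemma is_derive_cvg (V : normedModType R) (f : R -> V) (t : R) (l : V) :
  (fun h => h^-1 *: (f (h *: 1 + t) - f t)) @ 0^' --> l <->
  is_derive t 1 f l.
Proof.
split=> [fl|[df <-]]; last exact: df.
apply: DeriveDef; first by apply/cvg_ex; exists l.
exact/cvg_lim.
Qed.

Lemma is_derive_lin (V W : normedModType R) (phi : V -> W) (f : R -> V)
    (t : R) (df : V) : linear phi -> continuous phi ->
  is_derive t 1 f df -> is_derive t 1 (fun s => phi (f s)) (phi df).
Proof.
move=> lphi cphi /is_derive_cvg fdf; apply/is_derive_cvg.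
rewrite (_ : (fun h => _) =
    phi \o (fun h => h^-1 *: (f (h *: 1 + t) - f t))); last first.
  by apply/funext => h /=; rewrite (lin_scale lphi) (lin_sub lphi).
exact: (cvg_comp _ _ fdf (cphi df)).
Qed.

Lemma is_derive_pair (V W : normedModType R) (f : R -> V) (g : R -> W)
    (t : R) (df : V) (dg : W) : is_derive t 1 f df -> is_derive t 1 g dg ->
  is_derive t 1 (fun s => (f s, g s)) (df, dg).
Proof.
move=> /is_derive_cvg fdf /is_derive_cvg gdg; apply/is_derive_cvg.
exact: cvg_pair fdf gdg.
Qed.

Lemma is_derive_fst (V W : normedModType R) (f : R -> V * W) (t : R)
    (df : V * W) : is_derive t 1 f df -> is_derive t 1 (fun s => (f s).1) df.1.
Proof.
apply: (@is_derive_lin _ _ fst) => // x; exact: cvg_fst.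
Qed.

Lemma is_derive_snd (V W : normedModType R) (f : R -> V * W) (t : R)
    (df : V * W) : is_derive t 1 f df -> is_derive t 1 (fun s => (f s).2) df.2.
Proof.
apply: (@is_derive_lin _ _ snd) => // x; exact: cvg_snd.
Qed.

Lemma is_derive_coord d (f : R -> 'rV[R]_d) (t : R) (df : 'rV[R]_d) i :
  is_derive t 1 f df -> is_derive t 1 (fun s => f s 0 i) (df 0 i).
Proof.
apply: (@is_derive_lin _ _ (fun v : 'rV_d => v 0 i)).
  by move=> a u v; rewrite !mxE.
exact: coord_continuous.
Qed.

Lemma is_derive_mulmx d e (M : 'M[R]_(d, e)) (f : R -> 'rV[R]_d) (t : R)
    (df : 'rV[R]_d) :
  is_derive t 1 f df -> is_derive t 1 (fun s => f s *m M) (df *m M).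
Proof.
apply: (@is_derive_lin _ _ (mulmxr M)); last exact: mulmxr_continuous.
by move=> a u v /=; rewrite mulmxDl scalemxAl.
Qed.

Lemma is_derive_scalel (V : normedModType R) (f : R -> R) (t df : R) (v : V) :
  is_derive t 1 f df -> is_derive t 1 (fun s => f s *: v) (df *: v).
Proof.
apply: (@is_derive_lin _ _ (fun a : R => a *: v)).
  by move=> a x y; rewrite scalerDl scalerA.
exact: scalel_continuous.
Qed.

Lemma is_derive_sumr (V : normedModType R) n (f : 'I_n -> R -> V) (t : R)
    (df : 'I_n -> V) : (forall i, is_derive t 1 (f i) (df i)) ->
  is_derive t 1 (fun s => \sum_i f i s) (\sum_i df i).
Proof.
move=> /is_derive_sum; rewrite (_ : \sum_i f i = fun s => \sum_i f i s)//.
by apply/funext => s; rewrite fct_sumE.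
Qed.

Lemma is_derive_dotv d (f g : R -> 'rV[R]_d) (t : R) (df dg : 'rV[R]_d) :
  is_derive t 1 f df -> is_derive t 1 g dg ->
  is_derive t 1 (fun s => dotv (f s) (g s)) (dotv df (g t) + dotv (f t) dg).
Proof.
move=> fd gd; rewrite (_ : (fun s => _) = fun s => \sum_i f s 0 i * g s 0 i).
  have fgd i : is_derive t 1 (fun s => f s 0 i * g s 0 i)
      (df 0 i * g t 0 i + f t 0 i * dg 0 i).
    have fi := is_derive_coord i fd; have gi := is_derive_coord i gd.
    apply: is_derive_eq; rewrite /= addrC; congr (_ + _).
    by rewrite mulrC.
  by have := is_derive_sumr fgd; rewrite big_split /= !dotvE.
by apply/funext => s; rewrite dotvE.
Qed.

Lemma is_derive_rV_cst d (f : R -> 'rV[R]_d) :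
  (forall t : R, is_derive t 1 f 0) -> forall t, f t = f 0.
Proof.
move=> f0 t; apply/rowP => i; apply: (@is_derive_0_is_cst _ (fun s => f s 0 i)).
by move=> s; have := is_derive_coord i (f0 s); rewrite mxE.
Qed.

(** The Hamiltonian is half the square norm of a vector that is affine along every coordinate line,
    so each partial derivative is read off a quadratic polynomial in one variable. *)
Lemma derive_half_sqnorm (V : normedModType R) d (H : V -> R) (v w : V)
    (h e : 'rV[R]_d) : (forall a, H (a *: w + v) = 2^-1 * sqnorm (h + a *: e)) ->
  derive H v w = dotv h e.
Proof.
move=> HE.
pose phi (a : R) := 2^-1 * sqnorm h + a * dotv h e + a * a * (2^-1 * sqnorm e).
have phiE a : H (a *: w + v) = phi a.
  by rewrite HE sqnormD dotvZr sqnormZ /phi; field.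
have phi0 : H v = phi 0 by rewrite -phiE scale0r add0r.
transitivity (derive phi (0 : R) (1 : R)).
  have E : (fun a : R => a^-1 *: ((H \o shift v) (a *: w) - H v)) =
      (fun a : R => a^-1 *: ((phi \o shift (0 : R)) (a *: (1 : R)) - phi 0)).
    apply/funext => a /=.
    by rewrite phiE phi0 addr0 /GRing.scale /= mulr1.
  by rewrite /derive E.
have : is_derive (0 : R) (1 : R) phi (dotv h e).
  by apply: is_derive_eq; rewrite /GRing.scale /=; ring.
by move=> phid; rewrite derive_val.
Qed.

Lemma is_derive_sin_mul (w t : R) :
  is_derive t 1 (fun s => sin (w * s)) (w * cos (w * t)).
Proof. by apply: is_derive_eq; rewrite /GRing.scale /= mulr1 mulrC. Qed.

Lemma is_derive_cos_mul (w t : R) :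
  is_derive t 1 (fun s => cos (w * s)) (- (w * sin (w * t))).
Proof. by apply: is_derive_eq; rewrite /GRing.scale /= mulr1 mulrC mulrN. Qed.

End Derivatives.

(** * The group law and the Hamiltonian field in exponential coordinates *)

Section CarnotCoordinates.
Context {R : realType} {n : nat} {G : contact_carnot R n}.
Variable F : adapted_frame G.

Let ff : (n.*2).+1.-tuple G := [tuple of frame0 F :: frame1 F].
Local Notation A := (bracket_mx F).

Let ff_free : free ff.
Proof.
have f0 : frame0 F != 0.
  apply/eqP => f0; have := cc_dim2 G.
  by rewrite -(frame0_gen F) f0 dim_vline eqxx.
have := frame1_basis F => /andP[/eqP sp fr].
rewrite /ff /= -cat1s cat_free fr seq1_free f0 /= sp span_seq1 frame0_gen.
by have /directv_addP := cc_direct G; rewrite capvC => /directv_addP.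
Qed.

Let tnth_ff i : tnth (frame1 F) i = ff`_(lift ord0 i).
Proof. by rewrite (tnth_nth 0). Qed.

Let coord00 : coord ff ord0 (frame0 F) = 1.
Proof. by have := coord_free ord0 ord0 ff_free; rewrite eqxx. Qed.

Let coord0i i : coord ff ord0 (tnth (frame1 F) i) = 0.
Proof. by rewrite tnth_ff coord_free. Qed.

Let coordi0 i : coord ff (lift ord0 i) (frame0 F) = 0.
Proof. by have := coord_free ord0 (lift ord0 i) ff_free. Qed.

Let coordij i j : coord ff (lift ord0 i) (tnth (frame1 F) j) = (j == i)%:R.
Proof. by rewrite tnth_ff coord_free// (inj_eq lift_inj). Qed.

Let br_linl (w : G) : linear (fun u => @cc_br R n G u w).
Proof. by move=> a u v; exact: cc_br_linearl. Qed.

Let br_linr (w : G) : linear (@cc_br R n G w).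
Proof. by move=> a u v; exact: cc_br_linearr. Qed.

Let br_anti (u v : G) : cc_br u v = - cc_br v u.
Proof.
have := cc_br_alternating (u + v).
rewrite (lin_add (br_linl _)) !(lin_add (br_linr _)) !cc_br_alternating.
by rewrite addr0 add0r => /eqP; rewrite addr_eq0 => /eqP.
Qed.

(** [cc_br11] concerns brackets of basis vectors only; bilinearity extends it to all of g1. *)
Let br_g2 (u v : G) : u \in cc_g1 G -> v \in cc_g1 G -> cc_br u v \in cc_g2 G.
Proof.
move=> u1 v1; rewrite (coord_vbasis u1) (lin_comb (br_linl _)).
apply: memv_suml => i _; apply: memvZ.
rewrite (coord_vbasis v1) (lin_comb (br_linr _)).
apply: memv_suml => j _; apply: memvZ.
rewrite -(cc_br11 G); apply/memv_span/allpairsP.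
exists ((vbasis (cc_g1 G))`_i, (vbasis (cc_g1 G))`_j) => /=.
by split => //; apply: mem_nth; rewrite size_tuple.
Qed.

Let f1_g1 i : tnth (frame1 F) i \in cc_g1 G.
Proof. by apply: (basis_mem (frame1_basis F)); exact: mem_tnth. Qed.

Let f0_g2 : frame0 F \in cc_g2 G.
Proof. by rewrite -(frame0_gen F) memv_line. Qed.

Lemma bracket_mxE i j :
  cc_br (tnth (frame1 F) i) (tnth (frame1 F) j) = A i j *: frame0 F.
Proof.
have := br_g2 (f1_g1 i) (f1_g1 j); rewrite -(frame0_gen F) => /vlineP[c cE].
by rewrite mxE cE linearZ /= coord00 mulr1.
Qed.

Lemma bracket_mx_skew : A^T = - A.
Proof. by apply/matrixP => i j; rewrite !mxE br_anti linearN. Qed.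

(** f_0 is central, so only the brackets of the f_i survive and give the bilinear form of [A]. *)
Let br_exp (p q : coords R n) :
  cc_br (exp_coords F p) (exp_coords F q) = dotv (p.1 *m A) q.1 *: frame0 F.
Proof.
have g1 (r : coords R n) : \sum_i r.1 0 i *: tnth (frame1 F) i \in cc_g1 G.
  by apply: memv_suml => i _; apply: memvZ.
have g2 (a : R) : a *: frame0 F \in cc_g2 G by exact: memvZ.
rewrite /exp_coords (lin_add (br_linl _)) !(lin_add (br_linr _)).
rewrite (cc_br12 (g1 p) (g2 q.2)) (br_anti (p.2 *: _)) (cc_br12 (g1 q) (g2 p.2)).
rewrite (cc_br22 (g2 p.2) (g2 q.2)) oppr0 !addr0.
rewrite (lin_comb (br_linr _)) dotvE scaler_suml; apply: eq_bigr => j _.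
rewrite (lin_comb (br_linl _)) mxE mulr_suml scaler_suml scaler_sumr.
apply: eq_bigr => i _; rewrite bracket_mxE !scalerA; congr (_ *: _); ring.
Qed.

Let log_lin (a : R) (u v : G) :
  log_coords F (a *: u + v) = a *: log_coords F u + log_coords F v.
Proof.
rewrite /log_coords linearP; congr (_, _).
by apply/rowP => i; rewrite !mxE linearP.
Qed.

Let logK p : log_coords F (exp_coords F p) = p.
Proof.
case: p => x z; congr (_, _).
  apply/rowP => i; rewrite mxE /exp_coords linearD linear_sum linearZ /=.
  rewrite coordi0 mulr0 addr0 (bigD1 i)//= big1 ?addr0.
    by rewrite linearZ /= coordij eqxx mulr1.
  by move=> j /negPf ji; rewrite linearZ /= coordij ji mulr0.
rewrite /exp_coords linearD linear_sum linearZ /= coord00 mulr1.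
by rewrite big1 ?add0r// => i _; rewrite linearZ /= coord0i mulr0.
Qed.

Let log_f0 : log_coords F (frame0 F) = (0, 1).
Proof.
by rewrite /log_coords coord00; congr (_, _); apply/rowP => i; rewrite !mxE coordi0.
Qed.

Lemma group_mulE p q :
  group_mul F p q = (p.1 + q.1, p.2 + q.2 + 2^-1 * dotv (p.1 *m A) q.1).
Proof.
rewrite /group_mul /bch br_exp addrC log_lin -[exp_coords F p]scale1r log_lin.
rewrite scale1r !logK -[_ *: frame0 F]addr0 log_lin log_f0.
have -> : log_coords F 0 = 0.
  by rewrite -[0](subrr 0) -scaleN1r addrC log_lin scaleN1r addNr.
rewrite addr0 scalerA; case: p q => [x z] [x' z'] /=; congr (_, _) => /=.
  by rewrite scaler0 add0r.
by rewrite addrC /GRing.scale /= mulr1.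
Qed.

Lemma left_invariantE w p :
  left_invariant F w p = (w.1, w.2 + 2^-1 * dotv (p.1 *m A) w.1).
Proof.
rewrite /left_invariant derive1E.
(* The product is affine in [t], so the derivative is its slope. *)
rewrite (_ : (fun t => _) = fun t : R =>
  p + t *: (w.1, w.2 + 2^-1 * dotv (p.1 *m A) w.1)); last first.
  apply/funext => t; rewrite group_mulE; congr (_, _) => /=.
  rewrite dotvZr /GRing.scale /=; ring.
have h : is_derive (0 : R) 1 (fun t : R => t *: (w.1, w.2 + 2^-1 * dotv (p.1 *m A) w.1))
   (1 *: (w.1, w.2 + 2^-1 * dotv (p.1 *m A) w.1)).
  exact: is_derive_scalel.
have := is_deriveD (is_derive_cst p _ _) h.
by rewrite add0r scale1r => hd; rewrite derive_val.
Qed.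

Lemma hamiltonianE (s : coords R n * coords R n) :
  hamiltonian F s =
  2^-1 * sqnorm (s.2.1 + (s.2.2 / 2) *: (s.1.1 *m A)).
Proof.
rewrite /hamiltonian /sqnorm; congr (_ * _); apply: eq_bigr => i _.
congr (_ ^+ 2); rewrite /frame_field left_invariantE /pairing /= add0r -dotvE.
by rewrite !dotv_delta !mxE mulrA.
Qed.

(** The vector of the values <eta, f_i> at the point [s.1]; half its square norm is the
    Hamiltonian. *)
Definition momentum (s : coords R n * coords R n) : 'rV[R]_(n.*2) :=
  s.2.1 + (s.2.2 / 2) *: (s.1.1 *m A).

Lemma hamiltonian_fieldE s :
  hamiltonian_field F s =
  ((momentum s, 2^-1 * dotv (s.1.1 *m A) (momentum s)),
   ((s.2.2 / 2) *: (momentum s *m A), 0)).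
Proof.
case: s => [[x z] [y l]]; rewrite /hamiltonian_field /gradient /=.
rewrite /momentum /=; set h := y + _.
congr ((_, _), (_, _)).
- apply/rowP => i; rewrite mxE -dotv_delta; apply: derive_half_sqnorm => a.
  rewrite hamiltonianE /=; congr (_ * sqnorm _).
  by rewrite /h [a *: 0]mulr0 add0r -addrA addrC.
- rewrite -dotvZl dotvC; apply: derive_half_sqnorm => a.
  rewrite hamiltonianE /=; congr (_ * sqnorm _).
  rewrite /h scaler0 add0r -addrA; congr (_ + _).
  rewrite scalerA -scalerDl; congr (_ *: _); rewrite /GRing.scale /=; ring.
(* Moving [A] to the other factor costs a sign, which cancels the minus sign of Hamilton's second
   equation. *)
- apply/rowP => i; rewrite mxE /= mxE.
  rewrite (derive_half_sqnorm (h := h) (e := (l / 2) *: (delta_mx 0 i *m A))).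
    rewrite dotvZr dotvC dotv_mulmx bracket_mx_skew mulmxN dotvC -dotv_delta.
    by rewrite dotvNl dotvZl mulrN opprK.
  move=> a; rewrite hamiltonianE /=; congr (_ * sqnorm _).
  rewrite /h mulmxDl scalerDr -scalemxAl scalerA (addrC _ (_ *: (x *m A))) addrA.
  by congr (_ + _); rewrite scalerA mulrC.
(* The Hamiltonian does not involve z, which makes lambda a first integral. *)
- rewrite /= (derive_half_sqnorm (h := h) (e := 0)).
    by rewrite dotv0r oppr0.
  by move=> a; rewrite hamiltonianE /= !scaler0 add0r addr0.
Qed.

End CarnotCoordinates.

(** * Integral curves of the Hamiltonian field: uniqueness, construction and energy *)

Section Geodesics.
Context {R : realType} {n : nat} {G : contact_carnot R n}.
Variable F : adapted_frame G.
Local Notation A := (bracket_mx F).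
Implicit Types c : R -> coords R n * coords R n.

Lemma hamiltonian_curveP c : hamiltonian_curve F c -> forall t : R,
  [/\ is_derive t 1 (fun s => (c s).1.1) (momentum F (c t)),
      is_derive t 1 (fun s => (c s).1.2)
        (2^-1 * dotv ((c t).1.1 *m A) (momentum F (c t))),
      is_derive t 1 (fun s => (c s).2.1)
        (((c t).2.2 / 2) *: (momentum F (c t) *m A)) &
      is_derive t 1 (fun s => (c s).2.2) 0].
Proof.
move=> Hc t; have := Hc t; rewrite hamiltonian_fieldE => dc.
have dc1 := is_derive_fst dc; have dc2 := is_derive_snd dc.
split; first exact: is_derive_fst dc1.
- exact: is_derive_snd dc1.
- exact: is_derive_fst dc2.
- exact: is_derive_snd dc2.
Qed.

Lemma hamiltonian_curve_covector c (t : R) :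
  hamiltonian_curve F c -> (c t).2.2 = (c 0).2.2.
Proof.
move=> Hc; apply: (@is_derive_0_is_cst _ (fun s => (c s).2.2)) => s.
by case: (hamiltonian_curveP Hc s).
Qed.

(** The covector contributes half of the right-hand side; the position contributes the other half
    through x' = h, lambda being constant. *)
Lemma momentum_derive c (t : R) : hamiltonian_curve F c ->
  is_derive t 1 (fun s => momentum F (c s))
    ((c 0).2.2 *: (momentum F (c t) *m A)).
Proof.
move=> Hc; have [dx _ dy _] := hamiltonian_curveP Hc t.
have := is_deriveD dy (is_deriveZ ((c 0).2.2 / 2) (is_derive_mulmx A dx)).
rewrite (hamiltonian_curve_covector t Hc) -scalerDl -splitr.
rewrite [X in is_derive _ _ X _ -> _](_ : _ = fun s => momentum F (c s))//.
by apply/funext => s; rewrite /momentum (hamiltonian_curve_covector s Hc).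
Qed.

(* Two integral curves with the same initial value: the difference of their
   momenta has constant norm because A is skew. *)
Lemma hamiltonian_curve_unique c1 c2 :
  hamiltonian_curve F c1 -> hamiltonian_curve F c2 -> c1 0 = c2 0 -> c1 = c2.
Proof.
move=> H1 H2 c0; apply/funext => t.
have E22 s : (c1 s).2.2 = (c2 s).2.2.
  by rewrite (hamiltonian_curve_covector s H1) c0 (hamiltonian_curve_covector s H2).
pose D s := momentum F (c1 s) - momentum F (c2 s).
have dD (s : R) : is_derive s 1 D ((c1 0).2.2 *: (D s *m A)).
  have := is_deriveB (momentum_derive s H1) (momentum_derive s H2).
  by rewrite c0 -scalerBr -mulmxBl.
have D0 s : D s = 0.
  apply/eqP; rewrite -sqnorm_eq0 sqnormE.
  have dd (r : R) : is_derive r 1 (fun s => dotv (D s) (D s)) 0.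
    apply: is_derive_eq (is_derive_dotv (dD r) (dD r)) _.
    by rewrite dotvZl dotvZr dotvC (dotv_skew _ (bracket_mx_skew F)) mulr0 addr0.
  by rewrite (is_derive_0_is_cst s 0 dd) /D c0 subrr dotv0r.
have EM s : momentum F (c1 s) = momentum F (c2 s).
  by apply/eqP; rewrite -subr_eq0 -/(D s) D0.
have Ex s : (c1 s).1.1 = (c2 s).1.1.
  apply/eqP; rewrite -subr_eq0.
  have dd (r : R) : is_derive r 1 (fun s => (c1 s).1.1 - (c2 s).1.1) 0.
    have [d1 _ _ _] := hamiltonian_curveP H1 r.
    have [d2 _ _ _] := hamiltonian_curveP H2 r.
    by have := is_deriveB d1 d2; rewrite EM subrr.
  by rewrite (is_derive_rV_cst dd) c0 subrr.
have Ez s : (c1 s).1.2 = (c2 s).1.2.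
  apply/eqP; rewrite -subr_eq0; apply/eqP.
  have dd (r : R) : is_derive r 1 (fun s => (c1 s).1.2 - (c2 s).1.2) 0.
    have [_ d1 _ _] := hamiltonian_curveP H1 r.
    have [_ d2 _ _] := hamiltonian_curveP H2 r.
    by have := is_deriveB d1 d2; rewrite EM Ex subrr.
  by rewrite (is_derive_0_is_cst s 0 dd) c0 subrr.
have Ey : (c1 t).2.1 = (c2 t).2.1.
  by have := EM t; rewrite /momentum E22 Ex => /addIr.
move: (E22 t) (Ex t) (Ez t) Ey.
by case: (c1 t) (c2 t) => [[? ?] [? ?]] [[? ?] [? ?]] /= -> -> -> ->.
Qed.

(** h' is proportional to h A, which is orthogonal to h. Geodesics thus have constant speed, which
    gives the energy at once. *)
Lemma momentum_sqnorm c (t : R) : hamiltonian_curve F c ->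
  sqnorm (momentum F (c t)) = sqnorm (momentum F (c 0)).
Proof.
move=> Hc; rewrite !sqnormE.
have dd (r : R) :
    is_derive r 1 (fun s => dotv (momentum F (c s)) (momentum F (c s))) 0.
  have dM := momentum_derive r Hc.
  apply: is_derive_eq (is_derive_dotv dM dM) _.
  by rewrite dotvZl dotvZr dotvC (dotv_skew _ (bracket_mx_skew F)) mulr0 addr0.
exact: (is_derive_0_is_cst t 0 dd).
Qed.

(** Solving for x, h and z is enough: the first integral lambda x A = h - u turns h = y + (lambda /
    2) x A into the covector y = u + (h - u) / 2, which also makes sense for lambda = 0. *)
Lemma hamiltonian_curve_build (x h : R -> 'rV[R]_(n.*2)) (z : R -> R)
    (u : 'rV[R]_(n.*2)) (l : R) :
  (forall t, l *: (x t *m A) = h t - u) ->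
  (forall t : R, is_derive t 1 x (h t)) ->
  (forall t : R, is_derive t 1 h (l *: (h t *m A))) ->
  (forall t : R, is_derive t 1 z (2^-1 * dotv (x t *m A) (h t))) ->
  hamiltonian_curve F
    (fun t => ((x t, z t), (u + (2^-1 : R) *: (h t - u), l))).
Proof.
move=> lx dx dh dz t; rewrite hamiltonian_fieldE /=.
have -> : momentum F ((x t, z t), (u + (2^-1 : R) *: (h t - u), l)) = h t.
  rewrite /momentum /= mulrC -scalerA lx -addrA -scalerDl.
  by rewrite (_ : 2^-1 + 2^-1 = 1) ?scale1r ?[u + _]addrC ?subrK//; lra.
do 2 apply: is_derive_pair => //.
have := is_deriveD (is_derive_cst u t 1)
  (is_deriveZ 2^-1 (is_deriveB (dh t) (is_derive_cst u t 1))).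
by rewrite add0r subr0 scalerA mulrC.
Qed.

(** Uniqueness makes the choice in [lift_of] harmless: any explicit solution is the chosen one. *)
Lemma lift_ofE c eta :
  hamiltonian_curve F c -> c 0 = (0, eta) -> lift_of F eta = c.
Proof.
move=> Hc c0; apply: xget_unique => // c' [Hc' c'0].
by apply: hamiltonian_curve_unique => //; rewrite c0.
Qed.

Lemma J_sqnorm c eta : hamiltonian_curve F c -> c 0 = (0, eta) ->
  J F eta = 2^-1 * sqnorm eta.1.
Proof.
move=> Hc c0; rewrite /J /energy /geodesic (lift_ofE Hc c0); congr (_ * _).
rewrite (_ : (fun t => _) = cst (sqnorm eta.1)); last first.
  apply/funext => t; rewrite derive1E.
  have dc := is_derive_fst (Hc t).
  rewrite derive_val hamiltonian_fieldE /= (momentum_sqnorm t Hc) c0.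
  by rewrite /momentum /= mul0mx scaler0 addr0.
rewrite Rintegral_cst//= lebesgue_measure_itv/= lte_fin ltr01.
by rewrite -EFinD subr0 /= mulr1.
Qed.

End Geodesics.

(** * Componentwise complex multiplication on the eigenspaces *)

Section SpectralCombination.
Context {R : realType} {d : nat} (A : 'M[R]_d).
Context {k : nat} (alpha : 'I_k -> R) (m : 'I_k -> nat).
Hypothesis A_skew : A^T = - A.
Hypothesis Halpha : distinct_singular_values A alpha m.
Local Notation P := (spec_proj A alpha).
Implicit Types (u v : 'rV[R]_d) (a b : 'I_k -> R).

(* On each eigenspace A / alpha_j is a complex structure, so this is u_j
   multiplied by the complex number a_j + i alpha_j b_j. *)
Definition spec_comb a b u : 'rV[R]_d :=
  \sum_j (a j *: (u *m P j) + b j *: (u *m P j *m A)).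

Let sum_comp u : \sum_j u *m P j = u.
Proof. by rewrite -mulmx_sumr (sum_spec_proj Halpha) mulmx1. Qed.

Let comp_proj u j : u *m P j *m P j = u *m P j.
Proof. by rewrite -(mulmxA u (P j) (P j)) spec_projM. Qed.

Let comp_projA u i j : u *m P i *m A *m P j = u *m P i *m P j *m A.
Proof.
by rewrite -(mulmxA (u *m P i) A (P j)) (spec_proj_comm A_skew Halpha) mulmxA.
Qed.

Lemma spec_comp_orth u i j : i != j -> u *m P i *m P j = 0.
Proof.
by move=> ij; rewrite -(mulmxA u (P i) (P j)) (spec_proj_orth Halpha ij) mulmx0.
Qed.

Lemma spec_ext u v : (forall j, u *m P j = v *m P j) -> u = v.
Proof.
by move=> uv; rewrite -(sum_comp u) -(sum_comp v); apply: eq_bigr => j _.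
Qed.

Lemma dotv_spec u v : dotv u v = \sum_j dotv (u *m P j) (v *m P j).
Proof.
rewrite -{1}(sum_comp u) dotv_suml; apply: eq_bigr => j _.
by rewrite -{1}comp_proj dotv_mulmx (spec_proj_tr Halpha).
Qed.

Lemma sqnorm_spec u : sqnorm u = \sum_j sqnorm (u *m P j).
Proof. by rewrite sqnormE dotv_spec; apply: eq_bigr => j _; rewrite sqnormE. Qed.

Lemma spec_combP a b u j :
  spec_comb a b u *m P j = a j *: (u *m P j) + b j *: (u *m P j *m A).
Proof.
rewrite /spec_comb mulmx_suml (bigD1 j)//= big1 ?addr0 => [|i ij].
  by rewrite mulmxDl -!scalemxAl comp_projA comp_proj.
by rewrite mulmxDl -!scalemxAl comp_projA spec_comp_orth// mul0mx !scaler0 addr0.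
Qed.

Lemma spec_compA u j : u *m P j *m A *m A = - (alpha j ^+ 2) *: (u *m P j).
Proof.
rewrite -(mulmxA u (P j) A) -(mulmxA u (P j *m A) A).
by rewrite (spec_proj_sqr alpha A_skew) -scalemxAr.
Qed.

(** In the complex reading, right multiplication by [A] is multiplication by i alpha_j. *)
Lemma spec_comb_mulA a b u :
  spec_comb a b u *m A = spec_comb (fun j => - (alpha j ^+ 2) * b j) a u.
Proof.
rewrite /spec_comb mulmx_suml; apply: eq_bigr => j _.
by rewrite mulmxDl -!scalemxAl spec_compA scalerA addrC mulrC.
Qed.

Lemma spec_combZ c a b u :
  c *: spec_comb a b u = spec_comb (fun j => c * a j) (fun j => c * b j) u.
Proof.
by rewrite /spec_comb scaler_sumr; apply: eq_bigr => j _; rewrite scalerDr !scalerA.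
Qed.

Lemma spec_comb_subr a b u :
  spec_comb a b u - u = spec_comb (fun j => a j - 1) b u.
Proof.
rewrite -{2}(sum_comp u) /spec_comb -sumrB; apply: eq_bigr => j _.
by rewrite scalerBl scale1r addrAC.
Qed.

Lemma eq_spec_comb a b a' b' u :
  a =1 a' -> b =1 b' -> spec_comb a b u = spec_comb a' b' u.
Proof. by move=> aa bb; apply: eq_bigr => j _; rewrite aa bb. Qed.

Lemma is_derive_spec_comb (a b : R -> 'I_k -> R) a' b' u (t : R) :
  (forall j, is_derive t 1 (a^~ j) (a' j)) ->
  (forall j, is_derive t 1 (b^~ j) (b' j)) ->
  is_derive t 1 (fun s => spec_comb (a s) (b s) u) (spec_comb a' b' u).
Proof.
move=> da db; apply: is_derive_sumr => j.
exact: is_deriveD (is_derive_scalel _ (da j)) (is_derive_scalel _ (db j)).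
Qed.

Lemma dotv_compA u v j :
  dotv (u *m P j *m A) (v *m P j *m A) =
  alpha j ^+ 2 * dotv (u *m P j) (v *m P j).
Proof.
rewrite dotv_mulmx A_skew mulmxN dotvC dotvNl spec_compA dotvZl.
by rewrite mulNr opprK dotvC.
Qed.

Lemma dotv_comp_skew u j : dotv (u *m P j) (u *m P j *m A) = 0.
Proof. exact: dotv_skew. Qed.

(** The factor is the squared modulus of a + i alpha_j b. *)
Lemma sqnorm_compD (a b : R) u j :
  sqnorm (a *: (u *m P j) + b *: (u *m P j *m A)) =
  (a ^+ 2 + alpha j ^+ 2 * b ^+ 2) * sqnorm (u *m P j).
Proof.
rewrite sqnormD dotvZl dotvZr dotv_comp_skew !sqnormZ [sqnorm (_ *m A)]sqnormE.
rewrite dotv_compA -sqnormE; ring.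
Qed.

Lemma sqnorm_spec_comb a b u : sqnorm (spec_comb a b u) =
  \sum_j (a j ^+ 2 + alpha j ^+ 2 * b j ^+ 2) * sqnorm (u *m P j).
Proof.
rewrite sqnorm_spec; apply: eq_bigr => j _.
by rewrite spec_combP sqnorm_compD.
Qed.

Lemma dotv_spec_comb a b u :
  dotv u (spec_comb a b u) = \sum_j a j * sqnorm (u *m P j).
Proof.
rewrite dotv_spec; apply: eq_bigr => j _.
by rewrite spec_combP dotvDr !dotvZr dotv_comp_skew mulr0 addr0 sqnormE.
Qed.

End SpectralCombination.

(** * Explicit geodesics and the exponential map *)

Section ExponentialMap.
Context {R : realType} {n : nat} {G : contact_carnot R n}.
Variables (F : adapted_frame G) (k : nat) (alpha : 'I_k -> R) (m : 'I_k -> nat).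
Hypothesis Halpha : distinct_singular_values (bracket_mx F) alpha m.
Local Notation A := (bracket_mx F).
Local Notation P := (spec_proj A alpha).
Implicit Types (u : 'rV[R]_(n.*2)) (l t : R).

Let A_skew := bracket_mx_skew F.
Let alpha_neq0 j : alpha j != 0.
Proof. by rewrite gt_eqF// (dsv_pos Halpha). Qed.

(** Multiplies u_j by (e^(i w t) - 1) / (i w) with w = lambda alpha_j, the primitive of e^(i w t)
    vanishing at 0. The formula serves for lambda <> 0; lambda = 0 is treated apart. *)
Definition position u l t := spec_comb A alpha
  (fun j => (l * alpha j)^-1 * sin (l * alpha j * t))
  (fun j => (l * alpha j * alpha j)^-1 * (1 - cos (l * alpha j * t))) u.

(** Multiplies u_j by e^(i w t), with w = lambda alpha_j. *)
Definition velocity u l t := spec_comb A alpha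
  (fun j => cos (l * alpha j * t))
  (fun j => (alpha j)^-1 * sin (l * alpha j * t)) u.

Definition height u l t := \sum_j (2^-1 * l^-1 * sqnorm (u *m P j)) *
  (t - (l * alpha j)^-1 * sin (l * alpha j * t)).

Lemma position0 u l : position u l 0 = 0.
Proof.
rewrite /position /spec_comb big1// => j _.
by rewrite mulr0 sin0 cos0 subrr !mulr0 !scale0r addr0.
Qed.

Lemma velocity0 u l : velocity u l 0 = u.
Proof.
apply/eqP; rewrite -subr_eq0 /velocity (spec_comb_subr Halpha).
rewrite /spec_comb big1// => j _.
by rewrite mulr0 sin0 cos0 subrr mulr0 !scale0r addr0.
Qed.

Lemma height0 u l : height u l 0 = 0.
Proof. by rewrite /height big1// => j _; rewrite mulr0 sin0 mulr0 subr0 mulr0. Qed.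

Lemma position_velocity u l t : l != 0 ->
  l *: (position u l t *m A) = velocity u l t - u.
Proof.
move=> l0; rewrite /position (spec_comb_mulA alpha A_skew) spec_combZ.
rewrite /velocity (spec_comb_subr Halpha); apply: eq_spec_comb => j.
  by field; rewrite l0 alpha_neq0.
by field; rewrite l0 alpha_neq0.
Qed.

Lemma is_derive_position u l t : l != 0 ->
  is_derive t 1 (position u l) (velocity u l t).
Proof.
move=> l0; apply: is_derive_spec_comb => j.
  apply: is_derive_eq (is_deriveZ _ (is_derive_sin_mul _ _)) _.
  by rewrite /GRing.scale /= mulKf// mulf_neq0.
have d1 : is_derive t 1 (fun s => 1 - cos (l * alpha j * s))
    (l * alpha j * sin (l * alpha j * t)).
  have dc := is_derive_cos_mul (l * alpha j) t.
  by apply: is_derive_eq; ring.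
apply: is_derive_eq (is_deriveZ _ d1) _.
by rewrite /GRing.scale /=; field; rewrite l0 alpha_neq0.
Qed.

Lemma is_derive_velocity u l t :
  is_derive t 1 (velocity u l) (l *: (velocity u l t *m A)).
Proof.
have -> : l *: (velocity u l t *m A) = spec_comb A alpha
    (fun j => - (l * alpha j * sin (l * alpha j * t)))
    (fun j => (alpha j)^-1 * (l * alpha j * cos (l * alpha j * t))) u.
  rewrite /velocity (spec_comb_mulA alpha A_skew) spec_combZ.
  by apply: eq_spec_comb => j; field; rewrite alpha_neq0.
apply: is_derive_spec_comb => j; first exact: is_derive_cos_mul.
exact: (is_deriveZ _ (is_derive_sin_mul _ _)).
Qed.

Lemma sqnorm_velocity u l t : sqnorm (velocity u l t) = sqnorm u.
Proof.
rewrite /velocity (sqnorm_spec_comb A_skew Halpha) (sqnorm_spec Halpha u).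
apply: eq_bigr => j _; rewrite exprMn mulrA exprVn divff ?mul1r ?cos2Dsin2 ?mul1r//.
by rewrite sqrf_eq0.
Qed.

Lemma is_derive_height u l t : l != 0 ->
  is_derive t 1 (height u l)
    (2^-1 * dotv (position u l t *m A) (velocity u l t)).
Proof.
move=> l0.
(* With x A = (h - u) / lambda and |h| = |u|, the scalar product is (|u|^2 - u.h) / lambda, and u.h
   is the sum of the cos(w_j t) |u_j|^2. *)
have -> : 2^-1 * dotv (position u l t *m A) (velocity u l t) =
    \sum_j (2^-1 * l^-1 * sqnorm (u *m P j)) * (1 - cos (l * alpha j * t)).
  have -> : position u l t *m A = l^-1 *: (velocity u l t - u).
    by rewrite -position_velocity// scalerA mulVf// scale1r.
  rewrite dotvZl dotvBl -sqnormE sqnorm_velocity.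
  rewrite (dotv_spec_comb A_skew Halpha) (sqnorm_spec Halpha u).
  rewrite mulrA -sumrB mulr_sumr; apply: eq_bigr => j _; ring.
apply: is_derive_sumr => j.
apply: is_derive_eq (is_deriveZ _ (is_deriveB (is_derive_id _ _)
  (is_deriveZ _ (is_derive_sin_mul _ _)))) _.
by rewrite /GRing.scale /= mulKf// mulf_neq0.
Qed.

Lemma hamiltonian_curve_neq0 u l : l != 0 ->
  hamiltonian_curve F (fun t => ((position u l t, height u l t),
    (u + (2^-1 : R) *: (velocity u l t - u), l))).
Proof.
move=> l0.
apply: (@hamiltonian_curve_build _ _ _ F (position u l) (velocity u l)
  (height u l) u l) => t.
- exact: position_velocity.
- exact: is_derive_position.
- exact: is_derive_velocity.
- exact: is_derive_height.
Qed.

(** For lambda = 0 the geodesic is a straight line; its height stays 0 because (u A).u = 0 by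
    skewness. *)
Lemma hamiltonian_curve_eq0 u :
  hamiltonian_curve F (fun t => ((t *: u, 0), (u + (2^-1 : R) *: (u - u), 0))).
Proof.
apply: (@hamiltonian_curve_build _ _ _ F (fun t => t *: u) (fun=> u) (fun=> 0)) => t.
- by rewrite scale0r subrr.
- rewrite -[X in is_derive _ _ _ X]scale1r; exact: is_derive_scalel.
- by rewrite scale0r; exact: is_derive_cst.
- rewrite -scalemxAl dotvZl dotvC (dotv_skew _ (bracket_mx_skew F)) !mulr0; exact: is_derive_cst.
Qed.

Lemma lift_exists (eta : coords R n) :
  exists2 c, hamiltonian_curve F c & c 0 = (0, eta).
Proof.
case: eta => u l; have [->|l0] := eqVneq l 0.
  eexists; first exact: (hamiltonian_curve_eq0 u).
  by rewrite /= scale0r subrr scaler0 addr0.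
eexists; first exact: (hamiltonian_curve_neq0 u l0).
by rewrite /= position0 height0 velocity0 subrr scaler0 addr0.
Qed.

Lemma JE (eta : coords R n) : J F eta = 2^-1 * sqnorm eta.1.
Proof. by have [c Hc c0] := lift_exists eta; exact: J_sqnorm Hc c0. Qed.

Lemma exponential_map_eq0 u : exponential_map F (u, 0) = (u, 0).
Proof.
rewrite /exponential_map /geodesic (lift_ofE (hamiltonian_curve_eq0 u)) /=.
  by rewrite scale1r.
by rewrite scale0r subrr scaler0 addr0.
Qed.

Lemma exponential_map_neq0 u l : l != 0 ->
  exponential_map F (u, l) = (position u l 1, height u l 1).
Proof.
move=> l0.
rewrite /exponential_map /geodesic (lift_ofE (hamiltonian_curve_neq0 u l0))//=.
by rewrite position0 height0 velocity0 subrr scaler0 addr0.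
Qed.

End ExponentialMap.

(** * Zeros of the sine and analysis of the function g *)

Section Trigonometry.
Context {R : realType}.
Implicit Types x w : R.

Lemma sin_pi_int (q : int) : sin (pi * q%:~R) = 0 :> R.
Proof.
have sinn (i : nat) : sin (pi * i%:R) = 0 :> R.
  by rewrite mulr_natr -[pi *+ i]add0r (alternatingn (@sinDpi R)) sin0 mulr0.
case: q => i; first by rewrite -pmulrn sinn.
by rewrite NegzE rmorphN /= mulrN sinN -pmulrn sinn oppr0.
Qed.

(** Subtracting a multiple of pi brings x into [0, pi), where the sine vanishes only at 0. *)
Lemma sin_eq0P x : sin x = 0 <-> exists q : int, x = pi * q%:~R.
Proof.
split=> [sx|[q ->]]; last exact: sin_pi_int.
pose q := Num.floor (x / pi); exists q.
have pi0 : 0 < pi :> R by exact: pi_gt0.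
have /andP[q1 q2] : (q%:~R <= x / pi < (q + 1)%:~R) by exact: floor_itv.
have sr : sin (x - pi * q%:~R) = 0 by rewrite sinB sx sin_pi_int mul0r mulr0 subr0.
rewrite ler_pdivlMr// mulrC in q1.
rewrite ltr_pdivrMr// mulrC intrD mulrDr mulr1 in q2.
apply/eqP; rewrite -subr_eq0; apply/eqP.
have : 0 <= x - pi * q%:~R by rewrite subr_ge0.
rewrite le_eqVlt => /predU1P[//|r0].
have := @sin_gt0_pi R (x - pi * q%:~R).
by rewrite r0 ltrBlDl q2 sr ltxx => /(_ isT).
Qed.

Lemma cos_half x : 1 - cos x = 2 * sin (x / 2) ^+ 2.
Proof.
have {1}-> : x = (x / 2) *+ 2 by rewrite -mulr_natr mulfVK.
by rewrite cos_mulr2n cos2sin2 -mulr_natr; ring.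
Qed.

Lemma sin_half x : sin x = 2 * sin (x / 2) * cos (x / 2).
Proof.
have {1}-> : x = (x / 2) *+ 2 by rewrite -mulr_natr mulfVK.
by rewrite sin_mulr2n -mulr_natr; ring.
Qed.

Lemma cos_eq1 x : (cos x == 1) = (sin (x / 2) == 0).
Proof.
rewrite eq_sym -subr_eq0 cos_half mulf_eq0 sqrf_eq0.
by rewrite pnatr_eq0.
Qed.

Lemma MVT_is_derive (f f' : R -> R) (a b : R) : a < b ->
  (forall x, a <= x <= b -> is_derive x 1 f (f' x)) ->
  exists2 c, a < c < b & f b - f a = f' c * (b - a).
Proof.
move=> ab df.
have [||c] := @MVT R f f' a b ab; last by rewrite in_itv /=; exists c.
  by move=> x; rewrite in_itv /= => /andP[ax xb]; apply: df; rewrite !ltW.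
apply: derivable_within_continuous => x; rewrite in_itv /= => /df dx.
exact: ex_derive.
Qed.

Lemma derive_gt0_pos (f f' : R -> R) (b : R) : f 0 = 0 ->
  (forall x, is_derive x 1 f (f' x)) -> (forall x, 0 < x < b -> 0 < f' x) ->
  forall x, 0 < x <= b -> 0 < f x.
Proof.
move=> f0 df f'0 x /andP[x0 xb].
have [c /andP[c0 cx]] := @MVT_is_derive f f' 0 x x0 (fun y _ => df y).
rewrite f0 !subr0 => ->; rewrite mulr_gt0// f'0// c0.
exact: lt_le_trans cx xb.
Qed.

Lemma sin_le_id x : 0 < x -> sin x <= x.
Proof.
move=> x0; have [c _] := @MVT_is_derive sin cos 0 x x0 (fun y _ => is_derive_sin y).
rewrite sin0 !subr0 => ->; rewrite ler_piMl ?cos_le1//; exact: ltW.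
Qed.

(* The numerator of the second derivative of g. *)
Lemma g_convexity_numerator_gt0 w : 0 < w -> 0 < w * (2 + cos w) - 3 * sin w.
Proof.
move=> w0; have c1 := cos_geN1 w; have s1 := sin_le1 w.
have := @pi_ge2 R => pi2.
(* Beyond 2 pi the first term exceeds 4 while the second is at most 3; between pi and 2 pi the sine
   is nonpositive; up to pi, successive derivatives lead down to x sin x. *)
case: (leP w pi) => [wpi|piw]; last first.
  case: (leP w (2 * pi)) => [w2pi|w2pi].
    have : sin w <= 0.
      have := @sin_ge0_pi R (w - pi).
      rewrite sinB sinpi cospi mulr0 subr0 mulrN1 => /(_ _) h.
      rewrite -oppr_ge0; apply: h; lra.
    have : 0 < w * (2 + cos w) by rewrite mulr_gt0//; lra.
    by lra.
  have : w * 1 <= w * (2 + cos w) by rewrite ler_pM2l//; lra.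
  by lra.
have H1 x : 0 < x <= pi -> 0 < sin x - x * cos x.
  apply: (@derive_gt0_pos (fun x => sin x - x * cos x) (fun x => x * sin x)).
  - by rewrite sin0 mul0r subr0.
  - by move=> y; apply: is_derive_eq; rewrite /GRing.scale /=; ring.
  - by move=> y /andP[y0 ypi]; rewrite mulr_gt0// sin_gt0_pi// y0.
have H2 x : 0 < x <= pi -> 0 < 2 * (1 - cos x) - x * sin x.
  apply: (@derive_gt0_pos (fun x => 2 * (1 - cos x) - x * sin x)
     (fun x => sin x - x * cos x)).
  - by rewrite cos0 mul0r !subr0 subrr mulr0.
  - by move=> y; apply: is_derive_eq; rewrite /GRing.scale /=; ring.
  - by move=> y /andP[y0 ypi]; rewrite H1// y0 ltW.
apply: (@derive_gt0_pos (fun x => x * (2 + cos x) - 3 * sin x)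
  (fun x => 2 * (1 - cos x) - x * sin x) pi).
- by rewrite sin0 mul0r mulr0 subrr.
- by move=> y; apply: is_derive_eq; rewrite /GRing.scale /=; ring.
- by move=> y /andP[y0 ypi]; rewrite H2// y0 ltW.
- by rewrite w0.
Qed.

Lemma is_derive_div (f h : R -> R) (f' h' x : R) :
  is_derive x 1 f f' -> is_derive x 1 h h' -> h x != 0 ->
  is_derive x 1 (fun y => f y / h y) ((f' * h x - f x * h') / h x ^+ 2).
Proof.
move=> df dh h0.
have dV : is_derive x 1 (fun y => (h y)^-1) (- h x ^- 2 *: h').
  apply: DeriveDef; first by apply: derivableV => //; exact: ex_derive.
  by rewrite deriveV// derive_val.
apply: is_derive_eq; rewrite /GRing.scale /=; field.
by [].
Qed.

(* g off its poles; at a pole, x / 0 = 0 gives the junk value 0. *)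
Definition greal w : R := 8^-1 * ((w - sin w) / sin (w / 2) ^+ 2).
Definition greal1 w : R := (2 * (1 - cos w) - w * sin w) / (4 * (1 - cos w) ^+ 2).
Definition greal2 w : R := (w * (2 + cos w) - 3 * sin w) / (4 * (1 - cos w) ^+ 2).

(** A form without half angles, easier to differentiate. It holds at the poles too, where both sides
    are 0 by the convention on inverses. *)
Lemma greal_cos w : greal w = (w - sin w) / (4 * (1 - cos w)).
Proof.
rewrite /greal cos_half; set s := sin (w / 2) ^+ 2.
have [->|s0] := eqVneq s 0; first by rewrite !mulr0 invr0 !mulr0.
by field.
Qed.

Lemma is_derive_greal w : sin (w / 2) != 0 ->
  is_derive w 1 greal (greal1 w).
Proof.
move=> sw; have cw : 1 - cos w != 0 by rewrite subr_eq0 eq_sym cos_eq1.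
rewrite (_ : greal = fun w => (w - sin w) / (4 * (1 - cos w))); last first.
  by apply/funext => x; exact: greal_cos.
have dn : is_derive w 1 (fun w : R => w - sin w) (1 - cos w).
  by apply: is_derive_eq.
have dd : is_derive w 1 (fun w : R => 4 * (1 - cos w)) (4 * sin w).
  by apply: is_derive_eq; rewrite /GRing.scale /=; ring.
apply: is_derive_eq (is_derive_div dn dd _) _; first by rewrite mulf_neq0// pnatr_eq0.
have -> : (1 - cos w) * (4 * (1 - cos w)) - (w - sin w) * (4 * sin w) =
   4 * (2 * (1 - cos w) - w * sin w).
  by have := cos2Dsin2 w; lra.
by rewrite /greal1; field.
Qed.

Lemma is_derive_greal1 w : sin (w / 2) != 0 ->
  is_derive w 1 greal1 (greal2 w).
Proof.
move=> sw; have cw : 1 - cos w != 0 by rewrite subr_eq0 eq_sym cos_eq1.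
have dn : is_derive w 1 (fun w : R => 2 * (1 - cos w) - w * sin w)
    (sin w - w * cos w).
  by apply: is_derive_eq; rewrite /GRing.scale /=; ring.
have dd : is_derive w 1 (fun w : R => 4 * (1 - cos w) ^+ 2)
    (8 * (1 - cos w) * sin w).
  by apply: is_derive_eq; rewrite /GRing.scale /=; ring.
apply: is_derive_eq (is_derive_div dn dd _) _.
  by rewrite mulf_neq0 ?pnatr_eq0// sqrf_eq0.
(* Every term of the bracket below then has a factor 1 - cos w, which brings the denominator from a
   fourth power down to a square. *)
have E : sin w ^+ 2 = (1 - cos w) * (1 + cos w) by rewrite sin2cos2; ring.
have -> : (sin w - w * cos w) * (4 * (1 - cos w) ^+ 2) -
    (2 * (1 - cos w) - w * sin w) * (8 * (1 - cos w) * sin w) =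
    (1 - cos w) * 4 * ((sin w - w * cos w) * (1 - cos w) -
    4 * (1 - cos w) * sin w + 2 * w * sin w ^+ 2) by ring.
by rewrite E /greal2; field.
Qed.

Lemma greal2_gt0 w : 0 < w -> sin (w / 2) != 0 -> 0 < greal2 w.
Proof.
move=> w0 sw; have cw : 1 - cos w != 0 by rewrite subr_eq0 eq_sym cos_eq1.
rewrite divr_gt0 ?g_convexity_numerator_gt0// mulr_gt0// lt_neqAle sqr_ge0 andbT.
by rewrite eq_sym sqrf_eq0.
Qed.

(** Bounds sin(w / 2)^2 by 1 in the denominator and sin w by 1 in the numerator; this linear growth
    confines the solutions lambda. *)
Lemma greal_ge w : 0 < w -> sin (w / 2) != 0 -> (w - 1) / 8 <= greal w.
Proof.
move=> w0 sw; rewrite /greal mulrC ler_pM2l ?invr_gt0//.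
have sp : 0 < sin (w / 2) ^+ 2 by rewrite lt_neqAle sqr_ge0 andbT eq_sym sqrf_eq0.
have s1 : sin (w / 2) ^+ 2 <= 1.
  by have := cos2Dsin2 (w / 2); have := sqr_ge0 (cos (w / 2)); lra.
rewrite ler_pdivlMr//; have sw1 := sin_le1 w; have sw2 := sin_le_id w0.
have h1 : 0 <= (w - sin w) * (1 - sin (w / 2) ^+ 2) by rewrite mulr_ge0//; lra.
have h2 : 0 <= (1 - sin w) * sin (w / 2) ^+ 2 by rewrite mulr_ge0// ?ltW//; lra.
by lra.
Qed.

Lemma greal_ge0 w : 0 < w -> 0 <= greal w.
Proof.
move=> w0; rewrite /greal mulr_ge0// divr_ge0 ?sqr_ge0// subr_ge0.
exact: sin_le_id.
Qed.

Lemma grealN w : greal (- w) = - greal w.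
Proof. rewrite /greal sinN mulNr sinN sqrrN; ring. Qed.

End Trigonometry.

(** * Finiteness of the solutions of a weighted sum of values of g *)

Section FiniteSolutions.
Context {R : realType}.

(** Such a set has at most two elements; the ordered triples match the way strict convexity is
    used. *)
Lemma finite_no_chain3 (S : set R) :
  (forall a b c, S a -> S b -> S c -> a < b -> b < c -> False) -> finite_set S.
Proof.
move=> S3; have [->|/set0P[a Sa]] := eqVneq S set0; first exact: finite_set0.
have [Sa1|] := pselect (S `<=` [set a]).
  exact: sub_finite_set Sa1 (finite_set1 a).
move=> /existsNP[b /not_implyP[Sb ba]].
apply: (@sub_finite_set _ _ [set a; b]); last by rewrite finite_setU; split; exact: finite_set1.
move=> c Sc; apply: contrapT => /not_orP[ca cb].
have {}ba : b != a by exact/eqP.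
have {}ca : c != a by exact/eqP.
have {}cb : c != b by exact/eqP.
case: (ltgtP b a) ba => // ab _; case: (ltgtP c a) ca => // ac _;
  case: (ltgtP c b) cb => // bc _.
- exact: (S3 c b a).
- exact: (S3 b c a).
- by have := lt_trans (lt_trans ac bc) ab; rewrite ltxx.
- exact: (S3 b a c).
- exact: (S3 c a b).
- by have := lt_trans ab (lt_trans bc ac); rewrite ltxx.
- exact: (S3 a c b).
- exact: (S3 a b c).
Qed.

(** Rolle's theorem gives two zeros of the first derivative, hence a zero of the second between
    them. *)
Lemma strictly_convex_no_three (f f1 f2 : R -> R) (a b c : R) :
  a < b -> b < c ->
  (forall x, a <= x <= c -> is_derive x 1 f (f1 x)) ->
  (forall x, a <= x <= c -> is_derive x 1 f1 (f2 x)) ->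
  (forall x, a <= x <= c -> 0 < f2 x) ->
  f a = f b -> f b = f c -> False.
Proof.
move=> ab bc df df1 f2_gt0 fab fbc.
have dab x : a <= x <= b -> is_derive x 1 f (f1 x).
  by move=> /andP[ax xb]; apply: df; rewrite ax (le_trans xb)// ltW.
have [x /andP[ax xb]] := MVT_is_derive ab dab.
rewrite fab subrr => /esym/eqP; rewrite mulf_eq0 subr_eq0 (gt_eqF ab) orbF => /eqP x0.
have dbc y : b <= y <= c -> is_derive y 1 f (f1 y).
  by move=> /andP[b_y yc]; apply: df; rewrite yc andbT (le_trans _ b_y)// ltW.
have [y /andP[b_y yc]] := MVT_is_derive bc dbc.
rewrite fbc subrr => /esym/eqP; rewrite mulf_eq0 subr_eq0 (gt_eqF bc) orbF => /eqP y0.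
have xy : x < y := lt_trans xb b_y.
have dxy z : x <= z <= y -> is_derive z 1 f1 (f2 z).
  move=> /andP[xz zy]; apply: df1.
  by rewrite (le_trans (ltW ax) xz) (le_trans zy (ltW yc)).
have [z /andP[xz zy]] := MVT_is_derive xy dxy.
rewrite x0 y0 subrr => /esym/eqP; rewrite gt_eqF// mulr_gt0 ?subr_gt0//.
by rewrite f2_gt0// (ltW (lt_trans ax xz)) (ltW (lt_trans zy yc)).
Qed.

Variables (k : nat) (Q : pred 'I_k) (a c : 'I_k -> R).
Hypothesis a_gt0 : forall j, 0 < a j.
Hypothesis c_gt0 : forall j, Q j -> 0 < c j.
Hypothesis Q_ex : exists j, Q j.

Definition gsum (l : R) : R := \sum_(j | Q j) c j * greal (l * a j).

(** The poles are excluded explicitly, since [greal] takes a default value there. *)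
Definition gsum_sol (z : R) : set R :=
  [set l | (forall j, Q j -> sin (l * a j / 2) != 0) /\ gsum l = z].

Let is_derive_term (f f' : R -> R) (e : R) (l : R) j :
  is_derive (l * a j) 1 f (f' (l * a j)) ->
  is_derive l 1 (fun s => e * f (s * a j)) (e * a j * f' (l * a j)).
Proof.
move=> df; have dm : is_derive l 1 (fun s : R => s * a j) (a j).
  by apply: is_derive_eq; rewrite /GRing.scale /= mulr1 ?mulr0 ?add0r.
have h : is_derive l 1 (f \o (fun s => s * a j)) (f' (l * a j) * a j).
  exact: is_derive1_comp.
apply: is_derive_eq (is_deriveZ e h) _.
by rewrite /GRing.scale /=; ring.
Qed.

Let is_derive_sum_cond (f : 'I_k -> R -> R) (f' : 'I_k -> R) (l : R) :
  (forall j, Q j -> is_derive l 1 (f j) (f' j)) ->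
  is_derive l 1 (fun s => \sum_(j | Q j) f j s) (\sum_(j | Q j) f' j).
Proof.
move=> df; rewrite big_mkcond.
rewrite (_ : (fun s => _) = fun s => \sum_j (if Q j then f j s else 0)); last first.
  by apply/funext => s; rewrite big_mkcond.
apply: is_derive_sumr => j; case: ifPn => Qj; first exact: df.
exact: is_derive_cst.
Qed.

Let cell_no_three (x y z t : R) : 0 < x -> x < y -> y < z ->
  (forall l j, x <= l <= z -> Q j -> sin (l * a j / 2) != 0) ->
  gsum x = t -> gsum y = t -> gsum z = t -> False.
Proof.
move=> x0 xy yz ns gx gy gz.
apply: (@strictly_convex_no_three gsum
  (fun l => \sum_(j | Q j) c j * a j * greal1 (l * a j))
  (fun l => \sum_(j | Q j) c j * a j * a j * greal2 (l * a j))
  x y z xy yz); rewrite ?gx ?gy ?gz// => l xlz.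
- apply: is_derive_sum_cond => j Qj; apply: is_derive_term.
  by apply: is_derive_greal; exact: ns.
- apply: is_derive_sum_cond => j Qj; apply: is_derive_term.
  by apply: is_derive_greal1; exact: ns.
have l0 : 0 < l by case/andP: xlz => xl _; exact: lt_le_trans xl.
have [j Qj] := Q_ex.
have pos i : Q i -> 0 < c i * a i * a i * greal2 (l * a i).
  move=> Qi; apply: mulr_gt0; first by rewrite !mulr_gt0// c_gt0.
  by apply: greal2_gt0; [exact: mulr_gt0 | exact: ns].
rewrite (bigD1 j)//= ltr_pwDl ?pos// sumr_ge0// => i /andP[Qi _].
by rewrite ltW// pos.
Qed.

(** All terms are nonnegative, so a single one is at most z, and linear growth then bounds l. *)
Let bounded_sol z l : 0 < l -> gsum_sol z l ->
  exists2 j, Q j & l <= (8 * z / c j + 1) / a j.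
Proof.
move=> l0 [ns gl]; have [j Qj] := Q_ex; exists j => //.
have : c j * greal (l * a j) <= z.
  rewrite -gl /gsum (bigD1 j)//= lerDl sumr_ge0// => i /andP[Qi _].
  by rewrite mulr_ge0 ?greal_ge0 ?mulr_gt0// ltW// c_gt0.
have := greal_ge (mulr_gt0 l0 (a_gt0 j)) (ns j Qj).
rewrite ler_pdivlMr// -lerBlDr ler_pdivlMr ?c_gt0// => h1 h2.
have : c j * ((l * a j - 1) / 8) <= z.
  by apply: le_trans h2; rewrite ler_pM2l// c_gt0.
by lra.
Qed.

Let finite_pos z : finite_set (gsum_sol z `&` [set l | 0 < l]).
Proof.
have [B Bl] : exists B : nat, forall l j, 0 < l -> gsum_sol z l ->
    (Num.truncn (l * a j / (2 * pi)) < B)%N.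
  (* [b] dominates the bound of [bounded_sol] whichever index occurs in it, and [e] dominates the
     quotients for all j at once. *)
  pose b := \sum_(i < k) `|(8 * z / c i + 1) / a i|.
  pose e := \sum_(i < k) b * a i / (2 * pi).
  exists (Num.truncn e).+1 => l j l0 sl; rewrite ltnS.
  have p0 : 0 < 2 * pi :> R by rewrite mulr_gt0// pi_gt0.
  have b0 : 0 <= b by exact: sumr_ge0.
  apply: le_truncn; apply: (@le_trans _ _ (b * a j / (2 * pi))).
    rewrite ler_pM2r ?invr_gt0// ler_pM2r//.
    have [i Qi li] := bounded_sol l0 sl; apply: le_trans li _.
    rewrite /b (bigD1 i)//= (le_trans (ler_norm _))// lerDl; exact: sumr_ge0.
  rewrite /e (bigD1 j)//= lerDl sumr_ge0// => i _.
  by rewrite mulr_ge0 ?invr_ge0 ?(ltW p0)// mulr_ge0// ltW.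
(* Solutions with the same integer parts have no pole between them, so convexity allows at most two
   per cell. *)
pose cell l : {ffun 'I_k -> 'I_B.+1} :=
  [ffun j => inord (Num.truncn (l * a j / (2 * pi)))].
rewrite (_ : _ `&` _ = \bigcup_(v in [set: {ffun 'I_k -> 'I_B.+1}])
    [set l | [/\ gsum_sol z l, 0 < l & cell l = v]]); last first.
  by apply/seteqP; split => [l [sl l0]|l [v _ [? ? _]]]; [exists (cell l)|].
apply: bigcup_finite => [|v _]; first exact: finite_finset.
apply: finite_no_chain3 => x y t [[nx gx] x0 cx] [[ny gy] y0 cy] [[nt gt] t0 ct] xy yt.
apply: (@cell_no_three x y t z) => // l j /andP[xl lt] Qj.
have p0 : 0 < 2 * pi :> R by rewrite mulr_gt0// pi_gt0.
have pi0 : 0 < pi :> R by exact: pi_gt0.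
have /(congr1 val) := congr1 (fun f : {ffun 'I_k -> 'I_B.+1} => f j) (etrans cx (esym ct)).
rewrite !ffunE /= !inordK ?ltnS ?(ltnW (Bl _ _ _ _))// => trE.
set q := Num.truncn (x * a j / (2 * pi)) in trE.
have /andP[qx _] : q%:R <= x * a j / (2 * pi) < q.+1%:R.
  by apply: truncn_itv; rewrite divr_ge0 ?mulr_ge0// ltW.
have /andP[_ qt] : q%:R <= t * a j / (2 * pi) < q.+1%:R.
  by rewrite trE; apply: truncn_itv; rewrite divr_ge0 ?mulr_ge0// ltW.
(* A pole between x and t gives an integer r with q <= x a_j / (2 pi) <= r < q + 1, so r = q and x
   itself would be a pole. *)
apply/eqP => /sin_eq0P[r lr].
have lrE : l * a j / (2 * pi) = r%:~R.
  have -> : l * a j = 2 * (pi * r%:~R) by rewrite -lr; field.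
  by rewrite mulrA mulrAC divff ?mul1r ?gt_eqF.
have xlq : x * a j / (2 * pi) <= r%:~R.
  by rewrite -lrE !ler_pM2r// invr_gt0.
have rt : r%:~R <= t * a j / (2 * pi).
  by rewrite -lrE !ler_pM2r// invr_gt0.
have : (r%:~R : R) < q.+1%:R by exact: le_lt_trans qt.
rewrite pmulrn ltr_int => rq.
have : (q%:R : R) <= r%:~R by exact: le_trans xlq.
rewrite pmulrn ler_int => qr.
have rE : r = q :> int by apply/eqP; rewrite eq_le qr andbT -ltzD1 -PoszD addn1.
have : x * a j / (2 * pi) = q%:R.
  by apply/eqP; rewrite eq_le qx andbT; move: xlq; rewrite rE.
move=> xE; have := nx j Qj; rewrite (_ : x * a j / 2 = pi * (q%:Z)%:~R).
  by rewrite sin_pi_int eqxx.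
by rewrite -pmulrn -xE mulrCA invfM [pi * _]mulrCA divff ?mulr1 ?gt_eqF.
Qed.

(** g is odd, so negative solutions for z are the opposites of positive solutions for - z. *)
Lemma finite_gsum_sol z : finite_set (gsum_sol z `&` [set l | l != 0]).
Proof.
apply: (@sub_finite_set _ _ ((gsum_sol z `&` [set l | 0 < l]) `|`
    -%R @` (gsum_sol (- z) `&` [set l | 0 < l]))).
  move=> l [[ns gl] l0]; case: (ltgtP l 0) (l0 : l != 0) => // [ln|lp] _.
    right; exists (- l); last exact: opprK.
    split; last by rewrite /= oppr_gt0.
    split=> [j Qj|]; first by rewrite mulNr mulNr sinN oppr_eq0 ns.
    rewrite -gl /gsum -sumrN; apply: eq_bigr => j _.
    by rewrite mulNr grealN mulrN.
  by left.
rewrite finite_setU; split; first exact: finite_pos.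
by apply: finite_image; exact: finite_pos.
Qed.

End FiniteSolutions.

(** * The fibre of the exponential map, described level by level in lambda *)

Section GammaStructure.
Context {R : realType} {n : nat} {G : contact_carnot R n}.
Variables (F : adapted_frame G) (k : nat) (alpha : 'I_k -> R) (m : 'I_k -> nat).
Hypothesis Halpha : distinct_singular_values (bracket_mx F) alpha m.
Variable p : coords R n.
Local Notation A := (bracket_mx F).
Local Notation P := (spec_proj A alpha).
Implicit Types (u : 'rV[R]_(n.*2)) (l : R) (j : 'I_k).

Let A_skew := bracket_mx_skew F.
Let alpha_gt0 j : 0 < alpha j := dsv_pos Halpha j.
Let alpha_neq0 j : alpha j != 0.
Proof. by rewrite gt_eqF. Qed.

Let mem_LE l j : (j \in L alpha l) = (l \in Lambda_ alpha j).
Proof. by []. Qed.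

Lemma mem_L l j : (j \in L alpha l) = (l != 0) && (sin (l * alpha j / 2) == 0).
Proof.
rewrite mem_LE; apply/idP/andP => [/set_mem|[l0 /eqP /sin_eq0P[q lq]]].
  move=> -[l0 [q lE]]; split=> //; apply/eqP/sin_eq0P; exists q.
  by rewrite lE; field.
apply/mem_set; split=> //; exists q.
have -> : l = (l * alpha j / 2) * (2 / alpha j) by field.
by rewrite lq; field.
Qed.

Lemma LambdaP l : Lambda alpha l <-> exists j, j \in L alpha l.
Proof.
split=> [[j _ jl]|[j]]; first by exists j; rewrite mem_LE; exact: mem_set.
by rewrite mem_LE => /set_mem jl; exists j.
Qed.

Lemma Lambda_neq0 l : Lambda alpha l -> l != 0.
Proof. by move/LambdaP => [j]; rewrite mem_L => /andP[]. Qed.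

Lemma mem_I0 j : (j \in I0 F alpha p.1) = (p.1 *m P j == 0).
Proof. by rewrite inE. Qed.

(** Equal to 2 sin(w / 2)^2 with w = lambda alpha_j: the denominator that vanishes exactly when e^(i
    w) = 1. *)
Definition versin l j : R := 1 - cos (l * alpha j).

Lemma versin_neq0 l j : l != 0 -> j \notin L alpha l -> versin l j != 0.
Proof.
by move=> l0; rewrite mem_L l0 /= => s0; rewrite subr_eq0 eq_sym cos_eq1.
Qed.

Lemma mem_L_sin_cos l j : j \in L alpha l ->
  sin (l * alpha j) = 0 /\ cos (l * alpha j) = 1.
Proof.
rewrite mem_L => /andP[_ s0]; split.
  by rewrite sin_half (eqP s0) mulr0 mul0r.
by apply/eqP; rewrite cos_eq1.
Qed.

(* The value of u_j forced by x_j when lambda alpha_j is not a pole of g. *)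
Definition forced l j : 'rV[R]_(n.*2) :=
  (l * alpha j * sin (l * alpha j) / (2 * versin l j)) *: (p.1 *m P j) +
  (- l / 2) *: (p.1 *m P j *m A).

Lemma position_proj u l j : position F alpha u l 1 *m P j =
  ((l * alpha j)^-1 * sin (l * alpha j)) *: (u *m P j) +
  ((l * alpha j * alpha j)^-1 * versin l j) *: (u *m P j *m A).
Proof. by rewrite /position (spec_combP A_skew Halpha) mulr1. Qed.

(** The hypotheses say that a + i alpha_j b and a' + i alpha_j b' are inverse complex numbers. *)
Let comp_mul (a b a' b' : R) u j :
  a * a' - alpha j ^+ 2 * (b * b') = 1 -> a * b' + a' * b = 0 ->
  a' *: (a *: (u *m P j) + b *: (u *m P j *m A)) +
  b' *: ((a *: (u *m P j) + b *: (u *m P j *m A)) *m A) = u *m P j.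
Proof.
move=> h1 h2; rewrite mulmxDl -!scalemxAl (spec_compA alpha A_skew).
rewrite !scalerDr !scalerA [X in _ + X]addrC addrACA -!scalerDl.
have -> : a' * a + b' * b * - alpha j ^+ 2 = 1 by rewrite -[RHS]h1; ring.
have -> : a' * b + b' * a = 0 by rewrite -[RHS]h2; ring.
by rewrite scale1r scale0r addr0.
Qed.

Let cos_sin_id l j : sin (l * alpha j) ^+ 2 = versin l j * (2 - versin l j).
Proof. by rewrite /versin sin2cos2; ring. Qed.

(** Off the poles (e^(i w) - 1) / (i w) is nonzero, and [forced] multiplies x_j by its inverse. *)
Lemma position_notin_L u l j : l != 0 -> j \notin L alpha l ->
  position F alpha u l 1 *m P j = p.1 *m P j <-> u *m P j = forced l j.
Proof.
move=> l0 jL; have D0 := versin_neq0 l0 jL; rewrite position_proj /forced.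
have h1 : (l * alpha j)^-1 * sin (l * alpha j) *
    (l * alpha j * sin (l * alpha j) / (2 * versin l j)) -
    alpha j ^+ 2 * ((l * alpha j * alpha j)^-1 * versin l j * (- l / 2)) = 1.
  transitivity (sin (l * alpha j) ^+ 2 / (2 * versin l j) + versin l j / 2).
    by field; rewrite l0 alpha_neq0 D0.
  by rewrite cos_sin_id; field.
have h2 : (l * alpha j)^-1 * sin (l * alpha j) * (- l / 2) +
    l * alpha j * sin (l * alpha j) / (2 * versin l j) *
    ((l * alpha j * alpha j)^-1 * versin l j) = 0.
  by field; rewrite l0 alpha_neq0 D0.
split=> [<-|->]; first by rewrite comp_mul.
by rewrite comp_mul//; [rewrite -[RHS]h1; ring | rewrite -[RHS]h2; ring].
Qed.

(** Here e^(i w) = 1: the j-th component makes whole turns and closes up. *)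
Lemma position_in_L u l j : j \in L alpha l -> position F alpha u l 1 *m P j = 0.
Proof.
move=> jL; have [s0 c1] := mem_L_sin_cos jL.
by rewrite position_proj /versin s0 c1 subrr !mulr0 !scale0r addr0.
Qed.

Definition gweight j : R := alpha j * sqnorm (p.1 *m P j).

Definition noI0 : pred 'I_k := [pred j | j \notin I0 F alpha p.1].

(** The squared radius of the fibre at level lambda: what the forced components leave of z, rescaled
    by 2 lambda. *)
Definition rho l : R := 2 * l * (p.2 - gsum noI0 alpha gweight l).

Let height_term u l j : l != 0 -> j \notin L alpha l ->
  position F alpha u l 1 *m P j = p.1 *m P j ->
  2^-1 * l^-1 * sqnorm (u *m P j) * (1 - (l * alpha j)^-1 * sin (l * alpha j * 1)) =
  gweight j * greal (l * alpha j).
Proof.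
move=> l0 jL xE; have D0 := versin_neq0 l0 jL.
rewrite /gweight -xE position_proj (sqnorm_compD alpha A_skew) greal_cos mulr1.
rewrite -/(versin l j) !exprMn cos_sin_id.
by field; rewrite l0 alpha_neq0 D0.
Qed.

Lemma Gamma_neq0 u l : l != 0 -> Gamma F p (u, l) <->
  [/\ forall j, j \in L alpha l -> j \in I0 F alpha p.1,
      forall j, j \notin L alpha l -> u *m P j = forced l j &
      \sum_(j in L alpha l) sqnorm (u *m P j) = rho l].
Proof.
move=> l0; rewrite /Gamma /= (exponential_map_neq0 Halpha)//.
have heightE : (forall j, j \in L alpha l -> j \in I0 F alpha p.1) ->
    (forall j, j \notin L alpha l -> u *m P j = forced l j) ->
    height F alpha u l 1 = 2^-1 * l^-1 * \sum_(j in L alpha l) sqnorm (u *m P j)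
      + gsum noI0 alpha gweight l.
  move=> LI uE; rewrite /height (bigID (mem (L alpha l)))/=; congr (_ + _).
    rewrite mulr_sumr; apply: eq_bigr => j jL.
    by rewrite mulr1 (mem_L_sin_cos jL).1 mulr0 subr0 mulr1.
  (* Indices in [L] belong to [I0], and indices outside [L] with x_j = 0 have weight 0, so the
     complement of [L] and [noI0] give the same sum. *)
  rewrite /gsum [RHS]big_mkcond [LHS]big_mkcond; apply: eq_bigr => j _ /=.
  have [jL|jL] /= := boolP (j \in L alpha l).
    by rewrite /noI0 inE /= (LI j jL).
  rewrite height_term//; last by apply/(position_notin_L _ l0 jL); exact: uE.
  rewrite /noI0 inE /=; case: ifPn => //; rewrite negbK mem_I0 => /eqP x0.
  by rewrite /gweight x0 sqnorm0 mulr0 mul0r.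
have rhoE s : 2^-1 * l^-1 * s + gsum noI0 alpha gweight l = p.2 <-> s = rho l.
  rewrite /rho; split=> [<-|->]; first by field.
  by field.
split=> [pE|[LI uE sE]].
  have xE j : position F alpha u l 1 *m P j = p.1 *m P j by rewrite -pE.
  have zE : height F alpha u l 1 = p.2 by rewrite -pE.
  have LI j : j \in L alpha l -> j \in I0 F alpha p.1.
    by move=> jL; rewrite mem_I0 -xE position_in_L.
  have uE j : j \notin L alpha l -> u *m P j = forced l j.
    by move=> jL; apply/(position_notin_L _ l0 jL).
  by split=> //; apply/rhoE; rewrite -heightE.
have /rhoE zE := sE; rewrite -heightE// in zE; rewrite zE.
suff -> : position F alpha u l 1 = p.1 by case: (p).
apply: (spec_ext Halpha) => j; have [jL|jL] := boolP (j \in L alpha l).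
  by rewrite position_in_L//; have := LI j jL; rewrite mem_I0 => /eqP.
by apply/(position_notin_L _ l0 jL); exact: uE.
Qed.

Lemma Gamma_eq0 u : Gamma F p (u, 0) <-> p = (u, 0).
Proof. by rewrite /Gamma /= exponential_map_eq0; split=> ->. Qed.

(** Removes the extended reals: a pole at some j outside [I0] makes the sum infinite with the sign
    of lambda, so the product is -oo and never positive. *)
Lemma Lambda_pP l : Lambda_p F alpha p l <->
  [/\ Lambda alpha l,
      forall j, j \in L alpha l -> j \in I0 F alpha p.1 & 0 < rho l].
Proof.
rewrite /Lambda_p /=.
have [Ll|nL] := pselect (Lambda alpha l); last by split=> [[]|[]].
have l0 := Lambda_neq0 Ll.
have la0 j : l * alpha j != 0 by rewrite mulf_neq0.
have x_gt0 j : j \notin I0 F alpha p.1 -> 0 < sqnorm (p.1 *m P j).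
  by rewrite sqnorm_gt0 mem_I0.
set S := (\sum_(j < k | _) _)%E.
have [LI|] := pselect (forall j, j \in L alpha l -> j \in I0 F alpha p.1).
  have -> : S = (gsum noI0 alpha gweight l)%:E.
    rewrite /S /gsum -sumEFin; apply: eq_bigr => j jI.
    have sj : sin (l * alpha j / 2) != 0.
      by apply: contra jI => sj; apply: LI; rewrite mem_L l0.
    rewrite /g (negPf (la0 j)) (negPf sj) -!EFinM; congr (_%:E).
    by rewrite /gweight /greal mulrAC.
  rewrite -EFinB -EFinM lte_fin /rho.
  by split=> [[_ h]|[_ _ h]]; split=> //; [rewrite -mulrA mulr_gt0// mulrC|lra].
move=> nLI; have /existsNP[i /not_implyP[iL /negP iI]] := nLI.
split=> [[_]|[]//]; suff -> : ((p.2%:E - S) * l%:E = -oo)%E by [].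
have si : sin (l * alpha i / 2) == 0 by move: iL; rewrite mem_L l0.
case: (ltgtP l 0) (l0) => // [ln|lp] _.
  have -> : S = -oo%E.
    apply/esum_eqNyP; exists i; split=> //.
    rewrite /g (negPf (la0 i)) si ltNge pmulr_lle0// (ltW ln) /=.
    by rewrite gt0_muleNy ?lte_fin// gt0_mulNye// lte_fin x_gt0.
  by rewrite /= addey// lt0_mulye// lte_fin.
have -> : S = +oo%E.
  apply/esum_eqyP.
    move=> j jI; rewrite /g (negPf (la0 j)); case: ifP => sj.
      rewrite mulr_gt0// gt0_muley ?lte_fin// gt0_mulye// lte_fin.
      exact: x_gt0.
    by rewrite -!EFinM.
  exists i; split=> //; rewrite /g (negPf (la0 i)) si mulr_gt0//.
  by rewrite gt0_muley ?lte_fin// gt0_mulye// lte_fin x_gt0.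
by rewrite /= addeNy// gt0_mulNye// lte_fin.
Qed.

Definition projL l : 'M[R]_(n.*2) := \sum_(j in L alpha l) P j.

(** The centre of the sphere at level lambda; [projL] projects onto its directions. *)
Definition base l : 'rV[R]_(n.*2) :=
  \sum_(j | j \notin L alpha l) forced l j.

Let proj_sum (Q : pred 'I_k) u i : (u *m \sum_(j | Q j) P j) *m P i =
  if Q i then u *m P i else 0.
Proof.
rewrite mulmx_sumr mulmx_suml; case: ifPn => Qi.
  rewrite (bigD1 i)//= -(mulmxA u (P i) (P i)) spec_projM big1 ?addr0//.
  by move=> j /andP[_ ji]; rewrite (spec_comp_orth Halpha).
rewrite big1// => j Qj; rewrite (spec_comp_orth Halpha)//.
by apply: contraNneq Qi => <-.
Qed.

Lemma projLP u l i :
  u *m projL l *m P i = if i \in L alpha l then u *m P i else 0.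
Proof. exact: proj_sum. Qed.

Lemma baseP l i : base l *m P i = if i \in L alpha l then 0 else forced l i.
Proof.
have forcedP j : forced l j *m P i = if j == i then forced l i else 0.
  have -> : forced l j = spec_comb A alpha
      (fun i => if i == j then l * alpha j * sin (l * alpha j) / (2 * versin l j) else 0)
      (fun i => if i == j then - l / 2 else 0) p.1.
    rewrite /spec_comb (bigD1 j)//= eqxx big1 ?addr0// => a /negPf aj.
    by rewrite aj !scale0r addr0.
  rewrite (spec_combP A_skew Halpha) eq_sym; case: eqP => [->//|_].
  by rewrite !scale0r addr0.
rewrite /base mulmx_suml; case: ifPn => iL.
  rewrite big1// => j jL; rewrite forcedP ifN//.
  by apply: contraNneq jL => ->.
rewrite (bigD1 i iL) /= big1 => [|j /andP[_ /negPf ji]]; rewrite forcedP ?ji//.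
by rewrite eqxx addr0.
Qed.

Lemma sqnorm_projL u l :
  sqnorm (u *m projL l) = \sum_(j in L alpha l) sqnorm (u *m P j).
Proof.
rewrite (sqnorm_spec Halpha) [RHS]big_mkcond; apply: eq_bigr => j _.
by rewrite projLP; case: ifP => // _; rewrite sqnorm0.
Qed.

Lemma forced_base u l : (forall j, j \notin L alpha l -> u *m P j = forced l j) <->
  u - u *m projL l = base l.
Proof.
split=> [uE|uE j /negPf jL].
  apply: (spec_ext Halpha) => j; rewrite mulmxBl projLP baseP.
  by case: ifPn => [_|/uE ->]; rewrite ?subrr ?subr0.
have : (u - u *m projL l) *m P j = base l *m P j by rewrite uE.
by rewrite mulmxBl projLP baseP jL subr0.
Qed.

Lemma Gamma_sliceP u l : l != 0 -> Gamma F p (u, l) <->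
  [/\ forall j, j \in L alpha l -> j \in I0 F alpha p.1,
      u - u *m projL l = base l & sqnorm (u *m projL l) = rho l].
Proof.
move=> l0; rewrite Gamma_neq0// sqnorm_projL.
by split=> -[? /forced_base ? ?]; split.
Qed.

(** For j outside [L], x_j = 0 forces u_j = 0, so only the indices of [L] count. Gamma_0 and
    Gamma_inf are thus told apart by whether [rho] vanishes. *)
Let sum_I0 u l : l != 0 -> Gamma F p (u, l) ->
  \sum_(j in I0 F alpha p.1) sqnorm (component_of F alpha j u) = rho l.
Proof.
move=> l0 /(Gamma_neq0 _ l0)[LI uE <-].
rewrite big_mkcond [RHS]big_mkcond; apply: eq_bigr => j _.
have [jL|jL] := boolP (j \in L alpha l); first by rewrite LI.
rewrite mem_I0; case: eqP => // x0.
rewrite /component_of /orth_proj -/(P j) uE// /forced x0 mul0mx !scaler0 addr0.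
exact: sqnorm0.
Qed.

Lemma Gamma_infP u l : Gamma_inf F alpha p (u, l) <->
  [/\ Lambda_p F alpha p l, u - u *m projL l = base l &
      sqnorm (u *m projL l) = rho l].
Proof.
split=> [[Gu nG0]|[/Lambda_pP[Ll LI r0] uE sE]].
  (* At lambda = 0 one has u = x, which puts the covector in Gamma_0. *)
  have [l0|l0] := eqVneq l 0.
    exfalso; apply: nG0; split=> //; move: Gu; rewrite l0 => /Gamma_eq0 pE.
    rewrite big1// => j; rewrite pE /= => /eqP ->; exact: sqnorm0.
  have rE : rho l != 0.
    by apply/eqP => r0; apply: nG0; split=> //=; rewrite (sum_I0 l0 Gu).
  have /(Gamma_sliceP _ l0)[LI uE sE] := Gu.
  have r0 : 0 < rho l by rewrite lt_neqAle eq_sym rE -sE sqnorm_ge0.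
  split=> //; apply/Lambda_pP; split=> //; apply/LambdaP.
  (* An empty [L] would make the sum of squares, hence [rho], equal to 0. *)
  apply: contrapT => nL; move: rE; rewrite -sE sqnorm_projL big1 ?eqxx//.
  by move=> j jL; case: nL; exists j.
have l0 := Lambda_neq0 Ll.
have Gu : Gamma F p (u, l) by apply/(Gamma_sliceP _ l0).
by split=> // -[_ /=]; rewrite (sum_I0 l0 Gu) => rE; rewrite rE ltxx in r0.
Qed.

(** A zero radius reduces the sphere to its centre, so for lambda <> 0 the covector is determined by
    a solution lambda of the height equation. *)
Lemma Gamma0_sub : p <> (0, 0) ->
  Gamma0 F alpha p `<=` [set (p.1, 0)] `|`
    (fun l => (base l, l)) @` (gsum_sol noI0 alpha gweight p.2 `&` [set l | l != 0]).
Proof.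
move=> p0 [u l] [Gu /= s0]; have [l0|l0] := eqVneq l 0.
  by left; move: Gu; rewrite l0 => /Gamma_eq0 ->.
right; rewrite (sum_I0 l0 Gu) in s0.
have /(Gamma_sliceP _ l0)[LI uE sE] := Gu; exists l.
  split=> //; split=> [j jI|].
    by apply: contra jI => sj; apply: LI; rewrite mem_L l0.
  apply/eqP; rewrite eq_sym -subr_eq0.
  by move/eqP: s0; rewrite /rho !mulf_eq0 pnatr_eq0 (negPf l0).
have : sqnorm (u *m projL l) == 0 by rewrite sE s0.
by rewrite sqnorm_eq0 => /eqP u0; rewrite -uE u0 subr0.
Qed.

Lemma finite_Gamma0 : p <> (0, 0) -> finite_set (Gamma0 F alpha p).
Proof.
move=> p0; have [[j jI]|nI] := pselect (exists j, noI0 j).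
  apply: sub_finite_set (Gamma0_sub p0) _; rewrite finite_setU; split.
    exact: finite_set1.
  apply: finite_image; apply: finite_gsum_sol => //; last by exists j.
  move=> i; rewrite /noI0 inE mem_I0 => x0.
  by rewrite mulr_gt0// sqnorm_gt0.
(* With every index in [I0], x = 0. Then lambda = 0 gives z = 0, and lambda <> 0 equates z with an
   empty sum; either contradicts p <> p_0. *)
have x0 : p.1 = 0.
  apply: (spec_ext Halpha) => j; rewrite mul0mx; apply/eqP.
  by rewrite -mem_I0; apply: contrapT => /negP jI; apply: nI; exists j.
rewrite (_ : Gamma0 _ _ _ = set0); first exact: finite_set0.
rewrite -subset0 => -[u l] /[dup] [[Gu _]] /(Gamma0_sub p0)[[_ l0]|[l' [[_ gz] _] [_ l'l]]].
  by move: Gu; rewrite l0 => /Gamma_eq0 pE; apply: p0; rewrite pE -x0 pE.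
apply: p0; rewrite [p]surjective_pairing x0 -gz /gsum big1// => j jI.
by exfalso; apply: nI; exists j.
Qed.

Lemma countable_Lambda : countable (Lambda alpha).
Proof.
apply: bigcup_countable => // j _.
apply: (@sub_countable _ _ _ (range (fun q : int => 2 * pi / alpha j * q%:~R))).
  by apply: subset_card_le => l [_ [q ->]]; exists q.
exact: sub_countable (card_image_le _ _) (countableP _).
Qed.

Lemma countable_Gamma_snd : p <> (0, 0) -> countable (snd @` Gamma F p).
Proof.
move=> p0; apply: (@sub_countable _ _ _ (snd @` Gamma0 F alpha p `|` Lambda alpha)).
  apply: subset_card_le => l [[u l'] Gu /= <-].
  have [G0|nG0] := pselect (Gamma0 F alpha p (u, l')); first by left; exists (u, l').
  have /Gamma_infP[/Lambda_pP[Ll _ _] _ _] : Gamma_inf F alpha p (u, l') by split.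
  by right.
rewrite -bigcup2E; apply: bigcup_countable => // -[|[|i]] _ /=.
- by apply/finite_set_countable/finite_image; exact: finite_Gamma0.
- exact: countable_Lambda.
- exact: countable0.
Qed.

Lemma J_Gamma u u' l : Gamma F p (u, l) -> Gamma F p (u', l) ->
  J F (u, l) = J F (u', l).
Proof.
rewrite !(JE Halpha) /=; have [->|l0] := eqVneq l 0.
  by move=> /Gamma_eq0 pE /Gamma_eq0; rewrite pE => -[->].
move=> /(Gamma_neq0 _ l0)[_ uE sE] /(Gamma_neq0 _ l0)[_ uE' sE'].
congr (_ * _); rewrite !(sqnorm_spec Halpha) (bigID (mem (L alpha l)))/= sE.
rewrite [RHS](bigID (mem (L alpha l)))/= sE'; congr (_ + _).
by apply: eq_bigr => j jL; rewrite uE// uE'.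
Qed.

End GammaStructure.

(** * Discrete families of slices, connectedness and normalisation *)

Section Topology.
Context {R : realType}.

(** If some a <> x of [D] lies within delta / 2 of x, then any y of [D] closer to x than a must
    equal a, which is absurd; otherwise delta / 2 works. The point x need not lie in [D]. *)
Lemma separated_near (D : set R) (delta : R) : 0 < delta ->
  (forall a b, D a -> D b -> `|a - b| < delta -> a = b) ->
  forall x : R, \forall y \near x, D y -> y = x.
Proof.
move=> d0 sep x.
have [[a [Da ax nax]]|na] := pselect (exists a, [/\ D a, `|a - x| < delta / 2 & a != x]).
  apply/nbhs_ballP; exists `|a - x|; first by rewrite /= normr_gt0 subr_eq0.
  move=> y; rewrite /ball /= distrC => yx Dy; exfalso.
  have ya : y = a.
    apply: sep => //; have := ler_distD x y a; rewrite (distrC x a); lra.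
  by move: yx; rewrite ya ltxx.
apply/nbhs_ballP; exists (delta / 2); first by rewrite /= divr_gt0.
move=> y; rewrite /ball /= distrC => yx Dy; apply: contrapT => /eqP nyx.
by apply: na; exists y.
Qed.

Lemma lattice_near (c : R) : 0 < c -> forall x : R,
  \forall y \near x, (exists q : int, y = c * q%:~R) -> y = x.
Proof.
move=> c0; apply: (@separated_near [set y | exists q : int, y = c * q%:~R] c c0).
move=> _ _ [q ->] [r ->]; rewrite -mulrBr normrM gtr0_norm//.
rewrite -{2}[c]mulr1 ltr_pM2l// => h.
have : `|q - r| < 1 by rewrite -(ltr_int R) intr_norm intrB.
rewrite -[1]add0r ltzD1 => qr.
have : `|q - r| == 0 by rewrite eq_le normr_ge0 andbT.
by rewrite normr_eq0 subr_eq0 => /eqP ->.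
Qed.

(** Near level l only the slice at l is met, so a limit point of [S] at that level is a limit point
    of the slice. *)
Lemma closed_slices (V : topologicalType) (S : set (V * R)) (D : set R) :
  (forall v, S v -> D v.2) ->
  (forall x : R, \forall y \near x, D y -> y = x) ->
  (forall l, closed [set u | S (u, l)]) -> closed S.
Proof.
move=> SD Dn Sc [u l] ul; apply: (Sc l) => B Bu.
have nul : nbhs (u, l) (B `*` [set y | D y -> y = l]).
  by exists (B, [set y | D y -> y = l]) => //; split=> //; exact: Dn.
have [[u' l'] [Su /= [Bu' l'l]]] := ul _ nul.
by exists u'; split=> //=; rewrite -(l'l (SD _ Su)).
Qed.

(** The projection of [C] is an interval; if it contained two points it would have positive Lebesgue
    measure, unlike a countable set. *)
Lemma connected_countable_snd (V : topologicalType) (S C : set (V * R)) a b :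
  countable (snd @` S) -> C `<=` S -> connected C -> C a -> C b -> a.2 = b.2.
Proof.
move=> cS CS cC; wlog ab : a b / a.2 < b.2.
  move=> H Ca Cb; case: (ltgtP a.2 b.2) => // ab; first exact: H.
  by apply/esym; exact: H.
move=> Ca Cb.
have /connected_intervalP iC : connected (snd @` C).
  apply: connected_continuous_connected => //.
  by apply: continuous_subspaceT => x; exact: cvg_snd.
have sub : `[a.2, b.2]%classic `<=` snd @` S.
  move=> t /=; rewrite in_itv /= => tab.
  have [|||c Cc <-] := iC a.2 b.2 _ _ t; [by exists a|by exists b|by []|].
  by exists c => //; exact: CS.
have : countable `[a.2, b.2]%classic.
  exact: sub_countable (subset_card_le sub) cS.
move/countable_lebesgue_measure0; rewrite lebesgue_measure_itv /= lte_fin ab.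
by rewrite -EFinD => -[/eqP]; rewrite subr_eq0 gt_eqF.
Qed.

Definition normalize d (v : 'rV[R]_d) : 'rV[R]_d := (Num.sqrt (sqnorm v))^-1 *: v.

Lemma sqnorm_normalize d (v : 'rV[R]_d) : v != 0 -> sqnorm (normalize v) = 1.
Proof.
move=> v0; rewrite /normalize sqnormZ exprVn sqr_sqrtr ?sqnorm_ge0// mulVf//.
by rewrite sqnorm_eq0.
Qed.

Lemma normalizeZ d (a : R) (v : 'rV[R]_d) :
  0 < a -> normalize (a *: v) = normalize v.
Proof.
move=> a0; rewrite /normalize sqnormZ sqrtrM ?sqr_ge0// sqrtr_sqr gtr0_norm//.
by rewrite invfM scalerA mulrAC mulVf ?mul1r// gt_eqF.
Qed.

Lemma normalize_unit d (v : 'rV[R]_d) : sqnorm v = 1 -> normalize v = v.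
Proof. by move=> v1; rewrite /normalize v1 sqrtr1 invr1 scale1r. Qed.

Lemma normalize_continuous d (v : 'rV[R]_d) :
  v != 0 -> {for v, continuous (@normalize d)}.
Proof.
move=> v0.
have cs : {for v, continuous (fun w : 'rV[R]_d => Num.sqrt (sqnorm w))}.
  apply: (@continuous_comp _ _ _ (@sqnorm R d) (@Num.sqrt R)).
    exact: sqnorm_continuous.
  exact: sqrt_continuous.
have s0 : Num.sqrt (sqnorm v) != 0 by rewrite sqrtr_eq0 -ltNge sqnorm_gt0.
exact: cvgZ (cvgV s0 cs) (@cvg_id _ (nbhs v)).
Qed.

End Topology.

(** * Closedness of Gamma_inf and its homeomorphism with the spheres *)

Section Homeomorphism.
Context {R : realType} {n : nat} {G : contact_carnot R n}.
Variables (F : adapted_frame G) (k : nat) (alpha : 'I_k -> R) (m : 'I_k -> nat).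
Hypothesis Halpha : distinct_singular_values (bracket_mx F) alpha m.
Variable p : coords R n.
Local Notation A := (bracket_mx F).
Local Notation P := (spec_proj A alpha).
Local Notation Q := (projL F alpha).
Local Notation base := (base F alpha p).
Local Notation rho := (rho F alpha p).
Implicit Types (u : 'rV[R]_(n.*2)) (l : R) (j : 'I_k).

Lemma Lambda_near (x : R) : \forall l \near x, Lambda alpha l -> l = x.
Proof.
have H j : \forall l \near x, Lambda_ alpha j l -> l = x.
  have c0 : 0 < 2 * pi / alpha j.
    by rewrite divr_gt0 ?(dsv_pos Halpha)// mulr_gt0// pi_gt0.
  by apply: filterS (lattice_near c0 x) => l lx [_]; exact: lx.
have HA : \forall l \near x, forall j, Lambda_ alpha j l -> l = x.
  exact: (@filter_forall R 'I_k (fun j l => Lambda_ alpha j l -> l = x) (nbhs x)).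
by apply: filterS HA => l lx [j _]; exact: lx.
Qed.

Lemma closed_Gamma_inf : closed (Gamma_inf F alpha p).
Proof.
apply: (@closed_slices _ _ _ (Lambda alpha)).
- by move=> [u l] /(Gamma_infP Halpha)[/(Lambda_pP Halpha)[]].
- exact: Lambda_near.
move=> l; have [Ll|nL] := pselect (Lambda_p F alpha p l); last first.
  rewrite (_ : [set u | _] = set0); first exact: closed0.
  by rewrite -subset0 => u /(Gamma_infP Halpha)[].
(* The slice is cut out by two continuous equations: the forced part equals the centre, the free
   part has the given norm. *)
rewrite (_ : [set u | _] = [set u | u *m (1%:M - Q l) = base l] `&`
    [set u | sqnorm (u *m Q l) = rho l]); last first.
  apply/seteqP; split=> [u /(Gamma_infP Halpha)[_ uE sE]|u [/= uE sE]].
    by split=> //=; rewrite mulmxBr mulmx1.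
  by apply/(Gamma_infP Halpha); split=> //; rewrite -uE mulmxBr mulmx1.
apply: closedI; apply: closed_preimage1; first exact: mulmxr_continuous.
move=> u; apply: (@continuous_comp _ _ _ (mulmxr (Q l)) (@sqnorm R _)).
  exact: mulmxr_continuous.
exact: sqnorm_continuous.
Qed.

Let projL_idem l : Q l *m Q l = Q l.
Proof.
apply/row_matrixP => i; rewrite row_mul rowE; apply: (spec_ext Halpha) => j.
rewrite (projLP Halpha (delta_mx 0 i *m Q l)) (projLP Halpha (delta_mx 0 i)).
by case: (j \in L alpha l).
Qed.

Let frame_exists l : exists T : 'M[R]_((N alpha m l).*2, n.*2),
  row_free T /\ (T :=: Q l)%MS.
Proof.
have rk : \rank (Q l) = (N alpha m l).*2 by exact: rank_sum_spec_proj.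
rewrite -rk; exists (row_base (Q l)); split; first exact: row_base_free.
exact: eq_row_base.
Qed.

(** Its rows form a basis of the image of [projL], not necessarily orthonormal: [to_sphere] and
    [of_sphere] renormalise, which suffices for a homeomorphism. *)
Definition sphere_frame l : 'M[R]_((N alpha m l).*2, n.*2) :=
  sval (cid (frame_exists l)).

Local Notation T := sphere_frame.

Let T_free l : row_free (T l).
Proof. by rewrite /T; case: cid => ? []. Qed.

Let T_eq l : (T l :=: Q l)%MS.
Proof. by rewrite /T; case: cid => ? []. Qed.

Let TK l (v : 'rV[R]_((N alpha m l).*2)) : v *m T l *m pinvmx (T l) = v.
Proof. exact: mulmxKp. Qed.

Let TQ l : T l *m Q l = T l.
Proof.
have /submxP[X ->] : (T l <= Q l)%MS by rewrite T_eq.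
by rewrite -mulmxA projL_idem.
Qed.

Let QT l u : u *m Q l *m pinvmx (T l) *m T l = u *m Q l.
Proof. by apply: mulmxKpV; rewrite T_eq submxMl. Qed.

Let baseQ l : base l *m Q l = 0.
Proof.
apply: (spec_ext Halpha) => j; rewrite (projLP Halpha) (baseP Halpha) mul0mx.
by case: (j \in L alpha l).
Qed.

Definition to_sphere l u : 'rV[R]_((N alpha m l).*2) :=
  normalize (u *m Q l *m pinvmx (T l)).

Definition of_sphere l (v : 'rV[R]_((N alpha m l).*2)) : 'rV[R]_(n.*2) :=
  base l + Num.sqrt (rho l) *: normalize (v *m T l).

Let mulT_neq0 l (v : 'rV[R]_((N alpha m l).*2)) : v != 0 -> v *m T l != 0.
Proof. by apply: contraNneq => vT; rewrite -(TK v) vT mul0mx. Qed.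

Let projL_coord_neq0 l u : u *m Q l != 0 -> u *m Q l *m pinvmx (T l) != 0.
Proof. by apply: contraNneq => uT; rewrite -QT uT mul0mx. Qed.

Let unit_neq0 d (v : 'rV[R]_d) : sqnorm v = 1 -> v != 0.
Proof. by move=> v1; rewrite -sqnorm_eq0 v1 oner_neq0. Qed.

Let projL_neq0 u l : Gamma_inf F alpha p (u, l) -> u *m Q l != 0.
Proof.
move=> /(Gamma_infP Halpha)[/(Lambda_pP Halpha)[_ _ r0] _ sE].
by rewrite -sqnorm_eq0 sE gt_eqF.
Qed.

Let to_sphereP u l : Gamma_inf F alpha p (u, l) -> unit_sphere R _ (to_sphere l u).
Proof.
by move=> uG; apply/sqnorm_normalize/projL_coord_neq0; exact: projL_neq0.
Qed.

Let of_sphereQ l (v : 'rV[R]_((N alpha m l).*2)) :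
  of_sphere v *m Q l = Num.sqrt (rho l) *: normalize (v *m T l).
Proof.
by rewrite /of_sphere mulmxDl baseQ add0r /normalize -!scalemxAl -mulmxA TQ.
Qed.

Let of_sphereP l (v : 'rV[R]_((N alpha m l).*2)) : Lambda_p F alpha p l ->
  sqnorm v = 1 -> Gamma_inf F alpha p (of_sphere v, l).
Proof.
move=> Ll v1; apply/(Gamma_infP Halpha); split=> //.
  by rewrite of_sphereQ addrK.
have /(Lambda_pP Halpha)[_ _ r0] := Ll.
rewrite of_sphereQ sqnormZ sqnorm_normalize ?mulr1 ?sqr_sqrtr ?ltW//.
exact/mulT_neq0/unit_neq0.
Qed.

(** The change of basis is linear, so the inner normalisation is only a positive factor, which the
    outer one absorbs. *)
Let to_sphereK u l : Gamma_inf F alpha p (u, l) -> of_sphere (to_sphere l u) = u.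
Proof.
move=> uG; have /(Gamma_infP Halpha)[Ll uE sE] := uG.
have /(Lambda_pP Halpha)[_ _ r0] := Ll.
rewrite /of_sphere /to_sphere -uE {2}/normalize -scalemxAl QT normalizeZ.
  rewrite /normalize sE scalerA divff ?scale1r ?subrK//.
  by rewrite sqrtr_eq0 -ltNge.
rewrite invr_gt0 sqrtr_gt0 sqnorm_gt0.
by apply: projL_coord_neq0; exact: projL_neq0.
Qed.

Let of_sphereK l (v : 'rV[R]_((N alpha m l).*2)) : Lambda_p F alpha p l ->
  sqnorm v = 1 -> to_sphere l (of_sphere v) = v.
Proof.
move=> /(Lambda_pP Halpha)[_ _ r0] v1; rewrite /to_sphere of_sphereQ.
rewrite {2}/normalize -!scalemxAl TK !normalizeZ ?sqrtr_gt0 ?invr_gt0 ?sqrtr_gt0//.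
  exact: normalize_unit.
by rewrite sqnorm_gt0; apply/mulT_neq0/unit_neq0.
Qed.

Let index_proof (eta : Gamma_inf F alpha p) : Lambda_p F alpha p (set_val eta).2.
Proof.
have : Gamma_inf F alpha p (set_val eta) := set_valP eta.
by case: (set_val eta) => u l /(Gamma_infP Halpha)[].
Qed.

Let index (eta : Gamma_inf F alpha p) : Lambda_p F alpha p :=
  exist (fun l => l \in Lambda_p F alpha p) (set_val eta).2
    (mem_set (index_proof eta)).

Let fwd_proof (eta : Gamma_inf F alpha p) :
  unit_sphere R _ (to_sphere (set_val eta).2 (set_val eta).1).
Proof.
have : Gamma_inf F alpha p (set_val eta) := set_valP eta.
by case: (set_val eta) => u l; exact: to_sphereP.
Qed.

Let fwd (eta : Gamma_inf F alpha p) : spheres F alpha m p :=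
  existT (fun l : Lambda_p F alpha p => unit_sphere R (N alpha m (set_val l)).*2 : Type)
    (index eta) (exist (fun v => v \in unit_sphere R _)
      (to_sphere (set_val (index eta)) (set_val eta).1) (mem_set (fwd_proof eta))).

Let bwd_slice (l : Lambda_p F alpha p)
  (v : unit_sphere R (N alpha m (set_val l)).*2) : Gamma_inf F alpha p.
Proof.
exists (of_sphere (set_val v), set_val l); apply: mem_set.
by apply: of_sphereP; [exact: (set_valP l) | exact: (set_valP v)].
Defined.

Let bwd (s : spheres F alpha m p) : Gamma_inf F alpha p :=
  bwd_slice (projT2 s).

(** Taking [w] as a family over all reals lets [l'] be replaced by [l] without a cast between the
    fibres. *)
Let spheres_eq (w : forall r : R, 'rV[R]_((N alpha m r).*2))
    (l' l : Lambda_p F alpha p) (v : unit_sphere R (N alpha m (set_val l)).*2)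
    (pf : w (set_val l') \in unit_sphere R (N alpha m (set_val l')).*2) :
  set_val l' = set_val l -> w (set_val l) = set_val v ->
  existT (fun l : Lambda_p F alpha p =>
    unit_sphere R (N alpha m (set_val l)).*2 : Type) l' (exist _ (w (set_val l')) pf)
  = existT _ l v.
Proof.
move=> ll; have {}ll : l' = l by apply: val_inj.
by subst l' => wv; congr existT; apply: val_inj.
Qed.

Let fwdK : cancel fwd bwd.
Proof.
move=> eta; apply: val_inj.
change ((of_sphere (to_sphere (set_val eta).2 (set_val eta).1), (set_val eta).2)
  = set_val eta).
have : Gamma_inf F alpha p (set_val eta) := set_valP eta.
by case: (set_val eta) => u l uG /=; rewrite to_sphereK.
Qed.

Let bwdK : cancel bwd fwd.
Proof.
move=> [l v]; apply: (spheres_eq (w := fun r => to_sphere r (of_sphere (set_val v)))).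
  by [].
by apply: of_sphereK; [exact: (set_valP l) | exact: (set_valP v)].
Qed.

Let of_sphere_continuous l (v : 'rV[R]_((N alpha m l).*2)) :
  sqnorm v = 1 -> {for v, continuous (@of_sphere l)}.
Proof.
move=> v1.
have cn : {for v, continuous (fun w : 'rV[R]_((N alpha m l).*2) =>
    normalize (w *m T l))}.
  apply: (@continuous_comp _ _ _ (mulmxr (T l)) (@normalize R _)).
    exact: mulmxr_continuous.
  exact/normalize_continuous/mulT_neq0/unit_neq0.
exact: cvgD (cvg_cst _) (cvgZ (cvg_cst _) cn).
Qed.

Let to_sphere_continuous l u :
  u *m Q l != 0 -> {for u, continuous (to_sphere l)}.
Proof.
move=> u0; have -> : to_sphere l = fun w => normalize (w *m (Q l *m pinvmx (T l))).
  by apply/funext => w; rewrite mulmxA.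
apply: (@continuous_comp _ _ _ (mulmxr (Q l *m pinvmx (T l))) (@normalize R _)).
  exact: mulmxr_continuous.
apply: normalize_continuous => /=; rewrite mulmxA.
exact: projL_coord_neq0.
Qed.

Let bwd_continuous : continuous bwd.
Proof.
apply: (@sigT_continuous _ _ _ bwd_slice) => l.
apply: continuous_comp_initial => v.
have c1 : {for v, continuous
    (set_val : unit_sphere R (N alpha m (set_val l)).*2 -> _)}.
  exact: initial_continuous.
have c2 : {for v, continuous (@of_sphere (set_val l) \o set_val)}.
  apply: (continuous_comp c1); apply: of_sphere_continuous; exact: (set_valP v).
exact: cvg_pair c2 (cvg_cst _).
Qed.

Let fwd_continuous : continuous fwd.
Proof.
move=> eta U [V /= [[W oW <-]]] /= Wv VU.
pose l0 := (set_val eta).2.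
have etaG : Gamma_inf F alpha p (set_val eta) := set_valP eta.
have u0 : (set_val eta).1 *m Q l0 != 0.
  by apply: projL_neq0; move: etaG; rewrite /l0; case: (set_val eta).
(* [Lambda] is discrete, so points of Gamma_inf near [eta] share its lambda, and the fixed map
   [to_sphere l0] replaces the one that varies with lambda. *)
have near0 : \forall e \near set_val eta,
    (Lambda alpha e.2 -> e.2 = l0) /\ W (to_sphere l0 e.1).
  apply: filterI; first exact: (cvg_snd (Lambda_near l0)).
  have c1 : {for set_val eta, continuous (fun e : coords R n => to_sphere l0 e.1)}.
    apply: (@continuous_comp _ _ _ fst (to_sphere l0)).
      by move=> x; exact: cvg_fst.
    exact: to_sphere_continuous.
  by apply: c1; apply: open_nbhs_nbhs; split.
have : \forall e \near eta, (Lambda alpha (set_val e).2 -> (set_val e).2 = l0) /\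
    W (to_sphere l0 (set_val e).1).
  exact: initial_continuous near0.
apply: filterS => e [el eW].
have e2 : (set_val e).2 = l0.
  by apply: el; have /(Lambda_pP Halpha)[] := index_proof e.
have pf : unit_sphere R _ (to_sphere l0 (set_val e).1).
  by have := fwd_proof e; rewrite e2.
have fe : fwd e = existT
    (fun l : Lambda_p F alpha p => unit_sphere R (N alpha m (set_val l)).*2 : Type)
    (index eta) (exist (fun v => v \in unit_sphere R _)
      (to_sphere l0 (set_val e).1) (mem_set pf)).
  exact: (spheres_eq (w := fun r => to_sphere r (set_val e).1)).
by change (U (fwd e)); rewrite fe; exact: VU.
Qed.

Lemma Gamma_inf_homeomorphic :
  homeomorphic (Gamma_inf F alpha p) (spheres F alpha m p).
Proof.
exists fwd, bwd; split; [exact: fwdK | exact: bwdK | exact: fwd_continuous |].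
exact: bwd_continuous.
Qed.

End Homeomorphism.

Theorem theorem22 (R : realType) (n : nat) (G : contact_carnot R n)
    (F : adapted_frame G) (k : nat) (alpha : 'I_k -> R) (m : 'I_k -> nat)
    (Halpha : distinct_singular_values (bracket_mx F) alpha m)
    (p : coords R n) (Hp : p <> (0, 0)) :
  [/\ finite_set (Gamma0 F alpha p),
      closed (Gamma_inf F alpha p),
      homeomorphic (Gamma_inf F alpha p) (spheres F alpha m p) &
      forall eta eta' : coords R n, Gamma F p eta ->
        connected_component (Gamma F p) eta eta' -> J F eta = J F eta'].
Proof.
split.
- exact: (finite_Gamma0 Halpha).
- exact: (closed_Gamma_inf Halpha).
- exact: (Gamma_inf_homeomorphic Halpha).
move=> eta eta' Geta Ceta'.
have CG := @connected_component_sub _ (Gamma F p) eta.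
have El : eta.2 = eta'.2.
  apply: (connected_countable_snd (countable_Gamma_snd Halpha Hp) CG) => //.
    exact: component_connected.
  exact: connected_component_refl.
have := CG _ Ceta'; move: Geta El {Ceta' CG}.
by case: eta eta' => [u l] [u' l'] /= Gu <- Gu'; exact: (J_Gamma Halpha Gu Gu').
Qed.
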